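(* Let $M^{2n+s}(f(0),Q_0,\xi_i,\eta^i,g_0)$ be a weak $f$-K-contact manifold. Then there exist Riemannian metrics $g_t$ $(t\in\mathbb R)$ on $M$, equal to $g_0$ at $t=0$, such that each $(f(t),Q_t,\xi_i,\eta^i,g_t)$ is a weak $f$-K-contact structure on $M$ with structural tensors defined on $\mathcal D$ by $$Q_t=\frac1s\operatorname{Ric}^\bot_t,\qquad f(t)|_{\mathcal D}=T^\sharp_{\xi_i}(t).$$ Moreover, $g_t$ converges exponentially fast, as $t\to-\infty$, to a limit metric $\hat g$ with $\operatorname{Ric}^\bot_{\hat g}=s\,\mathrm{id}^\bot$ that gives an $f$-K-contact structure on $M$.
   Context: Let $n,s\ge1$ and let $M=M^{2n+s}$ be a smooth manifold of dimension $2n+s$. A weak metric $f$-structure on $M$ is a set $(f,Q,\xi_i,\eta^i,g)$ $(i=1,\dots,s)$, where $f$ is a $(1,1)$-tensor, $Q$ is a nonsingular $(1,1)$-tensor, $\xi_i$ are vector fields (the characteristic vector fields), $\eta^i$ are 1-forms and $g$ is a Riemannian metric, such that $$f^2=-Q+\sum_i\eta^i\otimes\xi_i,\quad \eta^i(\xi_j)=\delta^i_j,\quad Q\,\xi_i=\xi_i,$$ the $2n$-dimensional distribution $\mathcal D:=\bigcap_i\ker\eta^i$ is $f$-invariant, and $g(fX,fY)=g(X,QY)-\sum_i\eta^i(X)\,\eta^i(Y)$ for all vector fields $X,Y$. It follows that $f\xi_i=0$ and that $\ker f=\mathrm{span}(\xi_1,\dots,\xi_s)$ is the orthogonal complement of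 $\mathcal D$. Put $\Phi(X,Y)=g(X,fY)$. The exterior derivative of a 1-form is normalized by $d\eta(X,Y)=\frac12\{X(\eta(Y))-Y(\eta(X))-\eta([X,Y])\}$. The structure is weak $f$-contact if $\Phi=d\eta^1=\dots=d\eta^s$; a weak $f$-contact structure is weak $f$-K-contact if all $\xi_i$ are Killing for $g$. An $f$-K-contact structure is a weak $f$-K-contact structure with $Q=\mathrm{id}_{TM}$. For a vector $X$ write $X=X^\top+X^\bot$ with $X^\top=\sum_i\eta^i(X)\xi_i\in\ker f$ and $X^\bot\in\mathcal D$; $\mathrm{id}^\bot$ is the projection $X\mapsto X^\bot$. With $R_{X,Y}Z=(\nabla_X\nabla_Y-\nabla_Y\nabla_X-\nabla_{[X,Y]})Z$, the partial Ricci curvature tensor of a metric $g$ is $\operatorname{Ric}^\bot(X)=\sum_i(R_{X^\bot,\xi_i}\,\xi_i)^\bot$; $\operatorname{Ric}^\bot_t$ and $\operatorname{Ric}^\bot_{\hat g}$ are those of $g_t$ and $\hat g$. The integrability tensor of $\mathcal D$ is $T(X,Y)=\frac12(\nabla_XY-\nabla_YX)^\top$ for $X,Y\in\mathcal D$, and for $\xi\in\ker f$ the skew-symmetric operator $T^\sharp_\xi$ on $\mathcal D$ is given by $g(T^\sharp_\xi X,Y)=g(T(X,Y),\xi)$; $T^\sharp_{\xi_i}(t)$ is this operator for the metric $g_t$. *)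

(* Defs.v *)
From HB Require Import structures.
From mathcomp Require Import all_boot all_order all_algebra.
From mathcomp Require Import all_classical all_reals all_analysis.
Import Order.TTheory GRing.Theory Num.Theory.
Import numFieldNormedType.Exports.
Set Implicit Arguments.
Unset Strict Implicit.
Unset Printing Implicit Defensive.
Local Open Scope classical_set_scope.
Local Open Scope ring_scope.

(* C^k and C^oo maps on an open subset U of a finite-dimensional space. *)
Fixpoint Ck_on (R : realType) (V W : normedModType R) (k : nat)
    (U : set V) (F : V -> W) : Prop :=
  match k with
  | 0%N => forall x, U x -> {for x, continuous F}
  | k'.+1 => (forall x, U x -> differentiable F x) /\
             forall v : V, Ck_on k' U (fun x => 'D_v F x)
  end.

Definition smooth_on (R : realType) (V W : normedModType R)
    (U : set V) (F : V -> W) : Prop := forall k, Ck_on k U F.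

(* Iterated directional derivative along the constant directions in vs. *)
Definition iter_derive (R : realType) (V W : normedModType R)
    (vs : seq V) (F : V -> W) : V -> W :=
  foldr (fun v G => fun x => 'D_v G x) F vs.

(* Smooth manifolds without boundary. The chart i is the homeomorphism coord i
   from cdom i onto the open set coord i @` cdom i, with inverse param i; the
   values of coord i and param i outside these sets are irrelevant. *)
Record smooth_manifold (R : realType) (m : nat) := SmoothManifold {
  carrier :> topologicalType;
  chart_idx : Type;
  cdom : chart_idx -> set carrier;
  coord : chart_idx -> carrier -> 'rV[R]_m;
  param : chart_idx -> 'rV[R]_m -> carrier;
  carrier_hausdorff : hausdorff_space carrier;
  carrier_second_countable : @second_countable carrier;
  cdom_cover : forall p : carrier, exists i, cdom i p;
  cdom_open : forall i, open (cdom i);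
  cim_open : forall i, open (coord i @` cdom i);
  coordK : forall i p, cdom i p -> param i (coord i p) = p;
  coord_continuous : forall i p, cdom i p -> {for p, continuous (coord i)};
  param_continuous : forall i x, (coord i @` cdom i) x ->
    {for x, continuous (param i)};
  transition_smooth : forall i j,
    smooth_on (coord i @` (cdom i `&` cdom j)) (coord j \o param i)
}.

Section Tensors.
Variables (R : realType) (m : nat) (M : smooth_manifold R m).

(* A chart around p is chosen once and for all, and the tangent space T_pM is
   identified with R^m through that chart. Vectors are rows. *)
Definition chart_at (p : M) : chart_idx M := projT1 (cid (cdom_cover p)).

(* v *m coframe i p: the components in chart i of the tangent vector v at p. *)
Definition coframe (i : chart_idx M) (p : M) : 'M[R]_m :=
  jacobian (coord i \o param (chart_at p)) (coord (chart_at p) p).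

(* The rows of frame i p are the coordinate vectors of chart i at p. *)
Definition frame (i : chart_idx M) (p : M) : 'M[R]_m :=
  jacobian (coord (chart_at p) \o param i) (coord i p).

(* Fields of tangent vectors, covectors (u |-> u *m w), endomorphisms
   (u |-> u *m A) and bilinear forms ((u, v) |-> u *m B *m v^T). *)
Definition vfield := M -> 'rV[R]_m.
Definition covfield := M -> 'cV[R]_m.
Definition endofield := M -> 'M[R]_m.
Definition bilfield := M -> 'M[R]_m.

(* Component functions in chart i, on coord i @` cdom i. *)
Definition vrep (i : chart_idx M) (X : vfield) (x : 'rV[R]_m) : 'rV[R]_m :=
  X (param i x) *m coframe i (param i x).
Definition covrep (i : chart_idx M) (w : covfield) (x : 'rV[R]_m)
    : 'cV[R]_m :=
  frame i (param i x) *m w (param i x).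
Definition endorep (i : chart_idx M) (A : endofield) (x : 'rV[R]_m)
    : 'M[R]_m :=
  frame i (param i x) *m A (param i x) *m coframe i (param i x).
Definition bilrep (i : chart_idx M) (B : bilfield) (x : 'rV[R]_m)
    : 'M[R]_m :=
  frame i (param i x) *m B (param i x) *m (frame i (param i x))^T.

(* Smooth vector fields on an open subset W; values outside W are ignored. *)
Definition smooth_vfield_on (W : set M) (X : vfield) : Prop :=
  forall i, smooth_on (coord i @` (cdom i `&` W)) (vrep i X).
Definition smooth_vfield (X : vfield) : Prop := smooth_vfield_on setT X.
Definition smooth_covfield (w : covfield) : Prop :=
  forall i, smooth_on (coord i @` cdom i) (covrep i w).
Definition smooth_endofield (A : endofield) : Prop :=
  forall i, smooth_on (coord i @` cdom i) (endorep i A).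
Definition smooth_bilfield (B : bilfield) : Prop :=
  forall i, smooth_on (coord i @` cdom i) (bilrep i B).

Definition cov_app (w : covfield) (X : vfield) : M -> R :=
  fun p => (X p *m w p) 0 0.
Definition endo_app (A : endofield) (X : vfield) : vfield :=
  fun p => X p *m A p.
Definition bil_app (B : bilfield) (X Y : vfield) : M -> R :=
  fun p => (X p *m B p *m (Y p)^T) 0 0.

(* X(h) *)
Definition vderive (X : vfield) (h : M -> R) : M -> R := fun p =>
  'D_(X p) (h \o param (chart_at p) : 'rV[R]_m -> R^o)
    (coord (chart_at p) p).

Definition lie_bracket (X Y : vfield) : vfield := fun p =>
  let c := chart_at p in let x := coord c p in
  'D_(X p) (vrep c Y) x - 'D_(Y p) (vrep c X) x.

Definition ext_deriv (w : covfield) (X Y : vfield) : M -> R := fun p =>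
  2^-1 * (vderive X (cov_app w Y) p - vderive Y (cov_app w X) p
          - cov_app w (lie_bracket X Y) p).

Definition riemannian (g : bilfield) : Prop :=
  [/\ smooth_bilfield g,
      forall p, (g p)^T = g p
    & forall p (u : 'rV[R]_m), u != 0 -> 0 < (u *m g p *m u^T) 0 0].

(* Gamma(u, v), with components Gamma^k_{ij} u^i v^j, for the metric whose
   component matrix is G. *)
Definition christoffel (G : 'rV[R]_m -> 'M[R]_m) (x u v : 'rV[R]_m)
    : 'rV[R]_m :=
  2^-1 *: (v *m 'D_u G x + u *m 'D_v G x
           - \row_k (u *m 'D_(delta_mx 0 k) G x *m v^T) 0 0) *m invmx (G x).

(* The Levi-Civita connection of g: (nabla g X Y) is nabla_X Y. *)
Definition nabla (g : bilfield) (X Y : vfield) : vfield := fun p =>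
  let c := chart_at p in let x := coord c p in
  'D_(X p) (vrep c Y) x + christoffel (bilrep c g) x (X p) (Y p).

Definition curvature (g : bilfield) (X Y Z : vfield) : vfield := fun p =>
  nabla g X (nabla g Y Z) p - nabla g Y (nabla g X Z) p
  - nabla g (lie_bracket X Y) Z p.

Definition killing (g : bilfield) (X : vfield) : Prop :=
  forall (W : set M) (Y Z : vfield), open W ->
    smooth_vfield_on W Y -> smooth_vfield_on W Z ->
    forall p, W p ->
      vderive X (bil_app g Y Z) p
      = bil_app g (lie_bracket X Y) Z p + bil_app g Y (lie_bracket X Z) p.

Section Structures.
Variables (s : nat) (xi : 'I_s -> vfield) (eta : 'I_s -> covfield).

Definition in_D (p : M) (u : 'rV[R]_m) : Prop := forall i, u *m eta i p = 0.

Definition vtop (X : vfield) : vfield := fun p =>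
  \sum_(i < s) cov_app (eta i) X p *: xi i p.
Definition vbot (X : vfield) : vfield := fun p => X p - vtop X p.

Record weak_metric_f_structure (f Q : endofield) (g : bilfield) : Prop := {
  wf_smooth_f : smooth_endofield f;
  wf_smooth_Q : smooth_endofield Q;
  wf_smooth_xi : forall i, smooth_vfield (xi i);
  wf_smooth_eta : forall i, smooth_covfield (eta i);
  wf_riemannian : riemannian g;
  wf_Q_nonsingular : forall p, Q p \in unitmx;
  wf_f_square : forall p,
    f p *m f p = - Q p + \sum_(i < s) eta i p *m xi i p;
  wf_eta_xi : forall i j p, cov_app (eta i) (xi j) p = (i == j)%:R;
  wf_Q_xi : forall i p, endo_app Q (xi i) p = xi i p;
  wf_D_invariant : forall p u, in_D p u -> in_D p (u *m f p);
  wf_metric : forall X Y p,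
    bil_app g (endo_app f X) (endo_app f Y) p
    = bil_app g X (endo_app Q Y) p
      - \sum_(i < s) cov_app (eta i) X p * cov_app (eta i) Y p
}.

(* The 2-forms Phi(X, Y) = g(X, f Y) and d eta^i are compared on vector fields
   defined on arbitrary open subsets W of M. *)
Definition weak_f_contact (f Q : endofield) (g : bilfield) : Prop :=
  weak_metric_f_structure f Q g /\
  forall i (W : set M) (X Y : vfield), open W ->
    smooth_vfield_on W X -> smooth_vfield_on W Y ->
    forall p, W p ->
      bil_app g X (endo_app f Y) p = ext_deriv (eta i) X Y p.

Definition weak_f_K_contact (f Q : endofield) (g : bilfield) : Prop :=
  weak_f_contact f Q g /\ forall i, killing g (xi i).

Definition f_K_contact (f : endofield) (g : bilfield) : Prop :=
  weak_f_K_contact f (fun _ => 1%:M) g.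

Definition partial_ricci (g : bilfield) (X : vfield) : vfield := fun p =>
  \sum_(i < s) vbot (curvature g (vbot X) (xi i) (xi i)) p.

Definition integrability_tensor (g : bilfield) (X Y : vfield) : vfield :=
  vtop (fun p => 2^-1 *: (nabla g X Y p - nabla g Y X p)).

(* Smooth sections of D over the open subset W. *)
Definition D_section_on (W : set M) (X : vfield) : Prop :=
  smooth_vfield_on W X /\ forall p, W p -> in_D p (X p).

(* The restriction of F to D is the operator T^#_Z for the metric g. *)
Definition is_Tsharp (g : bilfield) (Z : vfield) (F : endofield) : Prop :=
  (forall p u, in_D p u -> in_D p (u *m F p)) /\
  forall (W : set M) (X Y : vfield), open W ->
    D_section_on W X -> D_section_on W Y ->
    forall p, W p ->
      bil_app g (endo_app F X) Y p = bil_app g (integrability_tensor g X Y) Z p.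

End Structures.

(* Joint smoothness of g t at p in (p, t). *)
Definition smooth_family (g : R -> bilfield) : Prop :=
  forall i, smooth_on [set z : 'rV[R]_m * R^o | (coord i @` cdom i) z.1]
    (fun z : 'rV[R]_m * R^o => bilrep i (g z.2) z.1).

(* Exponential convergence as t -> -oo in C^oo, uniformly on compact sets, with
   a rate c common to all compact sets and all orders of derivatives. *)
Definition exp_cvg_ninfty (g : R -> bilfield) (ghat : bilfield) : Prop :=
  exists2 c : R, 0 < c &
  forall i (K : set 'rV[R]_m) (vs : seq 'rV[R]_m),
    compact K -> K `<=` coord i @` cdom i ->
    exists C : R, forall t x, t <= 0 -> K x ->
      `|iter_derive vs (fun y => bilrep i (g t) y - bilrep i ghat y) x|
      <= C * expR (c * t).

End Tensors.

(* Main.v *)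
(* On the tangent bundle let S be the g_0-self-adjoint positive square root of
   Q_0; it fixes every xi_i and commutes with f(0).  The metrics are
     g_t(X, Y) = g_0(A_t X, Y),  A_t = phi(t) id + (1 - phi(t)) S,
   with phi(t) = exp(-t^2), so that g_t interpolates between g_0 (t = 0) and
   ghat = g_0(S ., .) (t -> -oo).  Put f(t) = A_t^-1 f(0) and
   Q_t = A_t^-2 Q_0: the 2-form g_t(X, f(t) Y) does not depend on t, so it
   remains d eta^i, and for ghat one gets Qhat = S^-2 Q_0 = id.

   The fields xi_i stay Killing because L_xi kills g_0, eta^j, d eta^j, hence
   f(0), Q_0, and then S, by uniqueness for the Sylvester equation
   S E + E S = 0.  Every weak f-K-contact structure satisfies
   nabla_X xi_i = - f X, so that R_{X,xi_i} xi_i = (L_{xi_i} f) X - f^2 X = Q X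
   on D, whence Ric^bot = s Q.

   S is smooth because S_y (S_y - S_x) + (S_y - S_x) S_x = Q_y - Q_x, where
   the Sylvester operator E |-> S_y E + E S_x is bounded below uniformly for y
   near x. *)

Require Import Defs.
From HB Require Import structures.
From mathcomp Require Import all_boot all_order all_algebra.
From mathcomp Require Import all_classical all_reals all_analysis.
From mathcomp Require Import complex ring lra.
Import Order.TTheory GRing.Theory Num.Theory.
Import numFieldNormedType.Exports.
Set Implicit Arguments.
Unset Strict Implicit.
Unset Printing Implicit Defensive.
Local Open Scope classical_set_scope.
Local Open Scope ring_scope.

(** No evolution equation is imposed on g_t, so an explicit path of metrics with the prescribed ends
    suffices. The weight phi has to be smooth on the whole line, equal to 1 at 0, valued in [0, 1]
    so that A_t is a convex combination of positive operators, and O(exp t) at minus infinity.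

    The obstacle is the square root. It is obtained pointwise by choice, so at first nothing relates
    its values at neighbouring points. Its commutation rules, invariance, continuity and derivatives
    are all extracted from S S = Q_0 and positivity, by injectivity or a lower bound of E |-> S E +
    E S'. Instead of diagonalizing, linear factors of an annihilating product are peeled off one at
    a time.

    A second difficulty is that T_pM is identified with R^m through [chart_at p], which jumps with
    p. Identities to be differentiated are therefore first proved at all points of one fixed chart,
    and only then read off at p in the chart [chart_at p], where frame and coframe are the
    identity. *)

Local Notation coord := Defs.coord.

(** * Calculus of C^k maps *)

Section Differentiability.
Variables (R : realType) (V W : normedModType R).

(** Little-o in epsilon form for a derivative guessed in advance. It serves where no differentiation
    rule applies, above all for the square root. *)
Lemma differentiable_eps (f L : V -> W) (x : V) : linear L -> continuous L ->
  (forall e : R, 0 < e ->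
     \forall h \near (0 : V), `|f (h + x) - f x - L h| <= e * `|h|) ->
  differentiable f x /\ forall v, 'D_v f x = L v.
Proof.
move=> Llin Lc H.
pose L' : {linear V -> W} :=
  HB.pack L (@GRing.isLinear.Build _ _ _ _ L Llin).
have fE : f \o shift x = cst (f x) + (L' : V -> W) +o_ (0 : V) id.
  apply/eqaddoP => e e0; near=> h.
  rewrite /= opprD addrA; near: h; exact: H.
have dE := @diff_unique _ _ _ f L' x Lc fE.
have df : differentiable f x.
  apply/diff_locallyP; rewrite dE; split => //.
by split => // v; rewrite deriveE // dE.
Unshelve. all: by end_near. Qed.

Lemma differentiable_near0 (f : V -> W) (x : V) : differentiable f x ->
  forall e : R, 0 < e ->
     \forall h \near (0 : V), `|f (h + x) - f x - 'd f x h| <= e * `|h|.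
Proof.
move=> /diff_locallyP[_ /eqaddoP fE] e e0.
by apply: filterS (fE e e0) => h; rewrite /= opprD addrA.
Qed.

Lemma near_eq_differentiable (f g : V -> W) (x : V) :
  (\forall y \near x, f y = g y) -> differentiable f x -> differentiable g x.
Proof.
move=> fg df; have [c dE] := (diff_locallyP _ _).1 df.
apply: (proj1 (@differentiable_eps _ ('d f x) x _ _ _)) => //.
  by move=> a u v; rewrite linearP.
move=> e e0; rewrite -(nbhs_singleton fg).
have fg0 : \forall h \near (0 : V), f (h + x) = g (h + x).
  have sc : (fun h => h + x) @ (0 : V) --> x.
    by rewrite -{2}(add0r x); apply: cvgD; [exact: cvg_id|exact: cvg_cst].
  exact: (sc _ fg).
near=> h.
have <- : f (h + x) = g (h + x) by near: h.
by near: h; exact: differentiable_near0.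
Unshelve. all: by end_near. Qed.

End Differentiability.

Section CkBasics.
Variables (R : realType) (V : normedModType R).
Implicit Types (U : set V).

Lemma Ck_on_sub (W : normedModType R) k U U' (F : V -> W) : U' `<=` U ->
  Ck_on k U F -> Ck_on k U' F.
Proof.
move=> UU'; elim: k F => [|k IH] F /=; first by move=> H x /UU'; exact: H.
by move=> [d H]; split=> [x /UU'|v]; [exact: d|exact: IH].
Qed.

Lemma Ck_onW (W : normedModType R) k U (F : V -> W) :
  Ck_on k.+1 U F -> Ck_on k U F.
Proof.
elim: k F => [|k IH] F /= [d H].
  by move=> x Ux; apply: differentiable_continuous; exact: d.
by split => // v; apply: IH; exact: H.
Qed.

(** Openness turns equality on U into equality near each point of U, so it survives differentiation.
    Later smoothness proofs rewrite a field as an explicit formula and conclude by this lemma. *)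
Lemma eq_Ck_on (W : normedModType R) k U (F H : V -> W) : open U ->
  (forall x, U x -> F x = H x) -> Ck_on k U F -> Ck_on k U H.
Proof.
move=> oU; elim: k F H => [|k IH] F H FH /=.
  move=> Fc x Ux; rewrite /prop_for /continuous_at -FH //.
  have := Fc x Ux; rewrite /prop_for /continuous_at; apply: cvg_trans.
  apply: near_eq_cvg; near=> y; apply: FH; near: y; exact: open_nbhs_nbhs.
move=> [d H']; split => [x Ux|v].
  apply: near_eq_differentiable (d x Ux).
  near=> y; apply: FH; near: y; exact: open_nbhs_nbhs.
apply: (IH _ _ _ (H' v)) => x Ux; apply: near_eq_derive.
near=> y; apply: FH; near: y; exact: open_nbhs_nbhs.
Unshelve. all: by end_near. Qed.

Lemma Ck_on_cst (W : normedModType R) k U (c : W) : Ck_on k U (fun _ => c).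
Proof.
elim: k c => [|k IH] c /=; first by move=> x _; exact: cvg_cst.
split => [x _|v]; first exact: differentiable_cst.
suff -> : (fun x : V => 'D_v (fun _ : V => c) x) = fun=> 0 by exact: IH.
by apply/funext => x; rewrite (derive_cst c).
Qed.

Lemma Ck_on_add (W : normedModType R) k U (F H : V -> W) : open U ->
  Ck_on k U F -> Ck_on k U H -> Ck_on k U (fun x => F x + H x).
Proof.
move=> oU; elim: k F H => [|k IH] F H /=.
  by move=> Fc Hc x Ux; apply: cvgD; [exact: Fc|exact: Hc].
move=> [dF DF] [dH DH]; split => [x Ux|v].
  by apply: differentiableD; [exact: dF|exact: dH].
apply: (eq_Ck_on oU _ (IH _ _ (DF v) (DH v))) => x Ux.
by rewrite -deriveD //; apply: diff_derivable; [exact: dF|exact: dH].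
Qed.

Lemma Ck_on_mul k U (F H : V -> R) : open U ->
  Ck_on k U F -> Ck_on k U H -> Ck_on k U (fun x => F x * H x).
Proof.
move=> oU; elim: k F H => [|k IH] F H.
  by move=> Fc Hc x Ux; apply: cvgM; [exact: Fc|exact: Hc].
move=> CF CH; have [[dF DF] [dH DH]] := (CF, CH); split => [x Ux|v].
  by apply: differentiableM; [exact: dF|exact: dH].
have F0 := Ck_onW CF; have H0 := Ck_onW CH.
have := Ck_on_add oU (IH _ _ F0 (DH v)) (IH _ _ H0 (DF v)).
apply: eq_Ck_on => // x Ux.
by rewrite (@deriveM _ _ F H) //; apply: diff_derivable; [exact: dF|exact: dH].
Qed.

(** The derivative - F^-2 D_v F contains F^-1 only undifferentiated, so the induction hypothesis
    covers it. *)
Lemma Ck_on_inv k U (F : V -> R) : open U -> (forall x, U x -> F x != 0) ->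
  Ck_on k U F -> Ck_on k U (fun x => (F x)^-1).
Proof.
move=> oU F0; elim: k => [|k IH].
  by move=> Fc x Ux; apply: cvgV; [exact: F0|exact: Fc].
move=> CF; have [dF DF] := CF; split => [x Ux|v].
  by apply: differentiableV; [exact: dF|exact: F0].
have {}IH := IH (Ck_onW CF).
have := Ck_on_mul oU
  (Ck_on_mul oU (Ck_on_cst k U (-1 : R)) (Ck_on_mul oU IH IH)) (DF v).
apply: eq_Ck_on => // x Ux.
rewrite deriveV; [|exact: F0|by apply: diff_derivable; exact: dF].
by rewrite expr2 invfM mulN1r.
Qed.

Lemma Ck_on_sum (W : normedModType R) k U (I : Type) (r : seq I)
    (P : pred I) (F : I -> V -> W) : open U ->
  (forall i, P i -> Ck_on k U (F i)) ->
  Ck_on k U (fun x => \sum_(i <- r | P i) F i x).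
Proof.
move=> oU HF; elim: r => [|i r IH].
  apply: (eq_Ck_on oU _ (Ck_on_cst k U 0)) => x _.
  by rewrite big_nil.
have [Pi|nPi] := boolP (P i).
  apply: (eq_Ck_on oU _ (Ck_on_add oU (HF i Pi) IH)) => x _.
  by rewrite big_cons Pi.
by apply: (eq_Ck_on oU _ IH) => x _; rewrite big_cons (negbTE nPi).
Qed.

Lemma Ck_on_prod k U (I : Type) (r : seq I) (F : I -> V -> R) : open U ->
  (forall i, Ck_on k U (F i)) -> Ck_on k U (fun x => \prod_(i <- r) F i x).
Proof.
move=> oU HF; elim: r => [|i r IH].
  apply: (eq_Ck_on oU _ (Ck_on_cst k U (1 : R))) => x _.
  by rewrite big_nil.
apply: (eq_Ck_on oU _ (Ck_on_mul oU (HF i) IH)) => x _.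
by rewrite big_cons.
Qed.

Lemma differentiable_mxP m n (F : V -> 'M[R]_(m, n)) x :
  differentiable F x <-> forall i j, differentiable (fun y => F y i j) x.
Proof.
split=> [dF i j|dF].
  have := @differentiable_comp _ _ _ _ F (fun N : 'M[R]_(m, n) => N i j) x dF.
  by apply; exact: differentiable_coord.
have -> : F = \sum_(i < m) \sum_(j < n)
    (fun y => F y i j *: (delta_mx i j : 'M[R]_(m, n))).
  apply/funext => y; rewrite fct_sumE [LHS]matrix_sum_delta.
  by apply: eq_bigr => i _; rewrite fct_sumE.
by do 2 (apply: differentiable_sum => ?); apply: differentiableZl.
Qed.

Lemma Ck_on_mxP k U m n (F : V -> 'M[R]_(m, n)) : open U ->
  Ck_on k U F <-> forall i j, Ck_on k U (fun x => F x i j).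
Proof.
move=> oU; elim: k F => [|k IH] F.
  split=> [Fc i j x Ux|Fc x Ux].
    apply: (@continuous_comp _ _ _ F (fun N : 'M[R]_(m, n) => N i j)).
      exact: Fc.
    exact: coord_continuous.
  apply/cvgrPdist_le => e e0; near=> y.
  rewrite /Num.Def.normr /= mx_normrE (bigmax_le _ (ltW e0)) //= => i _.
  rewrite !mxE /=; move: i; near: y; apply: filter_forall => /= i.
  by have /cvgrPdist_le := Fc i.1 i.2 x Ux; exact.
have E v x i j : differentiable F x ->
    'D_v F x i j = 'D_v (fun y => F y i j) x.
  by move=> dF; rewrite derive_mx ?mxE //; exact: diff_derivable.
split=> [[dF DF] i j|CF].
  split=> [x Ux|v]; first by apply/(differentiable_mxP F x).1; exact: dF.
  have := (IH _).1 (DF v) i j.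
  by apply: eq_Ck_on => // x Ux; rewrite E //; exact: dF.
have dF x : U x -> differentiable F x.
  by move=> Ux; apply/differentiable_mxP => i j; have [d _] := CF i j; exact: d.
split => // v; apply/IH => i j; have [_ DF] := CF i j.
by have := DF v; apply: eq_Ck_on => // x Ux; rewrite E //; exact: dF.
Unshelve. all: by end_near. Qed.

End CkBasics.

Section CkMatrix.
Variables (R : realType) (V : normedModType R).
Implicit Types (U : set V).

Lemma Ck_on_mulmx k U m n p (F : V -> 'M[R]_(m, n)) (H : V -> 'M[R]_(n, p)) :
  open U -> Ck_on k U F -> Ck_on k U H -> Ck_on k U (fun x => F x *m H x).
Proof.
move=> oU /(Ck_on_mxP _ _ oU) CF /(Ck_on_mxP _ _ oU) CH.
apply/(Ck_on_mxP _ _ oU) => i j.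
have C : Ck_on k U (fun x => \sum_l F x i l * H x l j).
  by apply: Ck_on_sum => // l _; exact: Ck_on_mul.
by apply: (eq_Ck_on oU _ C) => x _; rewrite mxE.
Qed.

Lemma Ck_on_scale k U m n (f : V -> R) (F : V -> 'M[R]_(m, n)) : open U ->
  Ck_on k U f -> Ck_on k U F -> Ck_on k U (fun x => f x *: F x).
Proof.
move=> oU Cf /(Ck_on_mxP _ _ oU) CF; apply/(Ck_on_mxP _ _ oU) => i j.
by apply: (eq_Ck_on oU _ (Ck_on_mul oU Cf (CF i j))) => x _; rewrite mxE.
Qed.

Lemma Ck_on_trmx k U m n (F : V -> 'M[R]_(m, n)) : open U ->
  Ck_on k U F -> Ck_on k U (fun x => (F x)^T).
Proof.
move=> oU /(Ck_on_mxP _ _ oU) CF; apply/(Ck_on_mxP _ _ oU) => i j.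
by apply: (eq_Ck_on oU _ (CF j i)) => x _; rewrite mxE.
Qed.

Lemma Ck_on_det k U n (F : V -> 'M[R]_n) : open U ->
  Ck_on k U F -> Ck_on k U (fun x => \det (F x)).
Proof.
move=> oU /(Ck_on_mxP _ _ oU) CF.
rewrite /determinant.
apply: Ck_on_sum => // s _; apply: Ck_on_mul => //; first exact: Ck_on_cst.
exact: Ck_on_prod.
Qed.

Lemma Ck_on_invmx k U n (F : V -> 'M[R]_n) : open U ->
  (forall x, U x -> F x \in unitmx) ->
  Ck_on k U F -> Ck_on k U (fun x => invmx (F x)).
Proof.
move=> oU Fu CF.
have C : Ck_on k U (fun x => (\det (F x))^-1 *: \adj (F x)).
  apply: Ck_on_scale => //.
    apply: Ck_on_inv => //; last exact: Ck_on_det.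
    by move=> x /Fu; rewrite unitmxE unitfE.
  apply/(Ck_on_mxP _ _ oU) => i j.
  have C : Ck_on k U (fun x => cofactor (F x) j i).
    apply: Ck_on_mul => //; first exact: Ck_on_cst.
    apply: Ck_on_det => //; apply/(Ck_on_mxP _ _ oU) => a b.
    have := (Ck_on_mxP k F oU).1 CF (lift j a) (lift i b).
    by apply: eq_Ck_on => // x _; rewrite !mxE.
  by apply: (eq_Ck_on oU _ C) => x _; rewrite mxE.
by apply: (eq_Ck_on oU _ C) => x Ux; rewrite /invmx Fu.
Qed.

Lemma derive_comp_rV m (W : normedModType R) (F : V -> 'rV[R]_m)
    (H : 'rV[R]_m -> W) x v : differentiable F x -> differentiable H (F x) ->
  'D_v (H \o F) x = 'D_('D_v F x) H (F x).
Proof.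
move=> dF dH; rewrite deriveE; last exact: differentiable_comp.
by rewrite diff_comp //= !deriveE.
Qed.

Lemma deriveZdir (W : normedModType R) (H : V -> W) x (a : R) v :
  differentiable H x -> 'D_(a *: v) H x = a *: 'D_v H x.
Proof. by move=> dH; rewrite !deriveE // linearZ. Qed.

Lemma derive_rV (W : normedModType R) m (H : 'rV[R]_m -> W) x v :
  differentiable H x ->
  'D_v H x = \sum_j v 0 j *: 'D_(delta_mx 0 j) H x.
Proof.
move=> dH; rewrite deriveE // {1}[v]row_sum_delta linear_sum.
by apply: eq_bigr => j _; rewrite linearZ deriveE.
Qed.

(** [Ck_on] differentiates along constant directions only, while the chain rule produces the moving
    direction D_v F x. Expanding it over the coordinate basis gives a sum of products to which the
    induction hypothesis applies. *)
Lemma Ck_on_comp k U m (U' : set 'rV[R]_m) (F : V -> 'rV[R]_m)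
    (H : 'rV[R]_m -> R) : open U -> (forall x, U x -> U' (F x)) ->
  Ck_on k U F -> Ck_on k U' H -> Ck_on k U (fun x => H (F x)).
Proof.
move=> oU UU'; elim: k H => [|k IH] H CF CH.
  move=> x Ux; apply: (@continuous_comp _ _ _ F H); first exact: CF.
  by apply: CH; exact: UU'.
have [[dF DF] [dH DH]] := (CF, CH).
split=> [x Ux|v].
  apply: (@differentiable_comp _ _ _ _ F H); first exact: dF.
  by apply: dH; exact: UU'.
have C : Ck_on k U
    (fun x => \sum_j 'D_v F x 0 j * 'D_(delta_mx 0 j) H (F x)).
  apply: Ck_on_sum => // j _; apply: Ck_on_mul => //.
    by have /(Ck_on_mxP _ _ oU) := DF v; exact.
  by apply: (IH (fun y => 'D_(delta_mx 0 j) H y) (Ck_onW CF) (DH _)).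
apply: (eq_Ck_on oU _ C) => x Ux.
have dFx := dF x Ux; have dHx := dH _ (UU' x Ux).
by rewrite (derive_comp_rV v dFx dHx) derive_rV.
Qed.

Lemma Ck_on_compmx k U m p q (U' : set 'rV[R]_m) (F : V -> 'rV[R]_m)
    (H : 'rV[R]_m -> 'M[R]_(p, q)) : open U -> open U' ->
  (forall x, U x -> U' (F x)) ->
  Ck_on k U F -> Ck_on k U' H -> Ck_on k U (fun x => H (F x)).
Proof.
move=> oU oU' UU' CF /(Ck_on_mxP _ _ oU') CH; apply/(Ck_on_mxP _ _ oU) => i j.
exact: (Ck_on_comp oU UU' CF (CH i j)).
Qed.

Lemma is_derive_mx m n (F : V -> 'M[R]_(m, n)) x v (D : 'M[R]_(m, n)) :
  is_derive x v F D <-> forall i j, is_derive x v (fun y => F y i j) (D i j).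
Proof.
split=> [[dF <-] i j|H].
  by split; [exact: (derivable_mxP F x v).1|rewrite derive_mx // mxE].
have dF : derivable F x v.
  by apply/(derivable_mxP F x v).2 => i j; have [] := H i j.
split => //; rewrite derive_mx //; apply/matrixP => i j; rewrite mxE.
by have [] := H i j.
Qed.

Lemma is_derive_mulmx m n p (F : V -> 'M[R]_(m, n)) (H : V -> 'M[R]_(n, p))
    x v DF DH : is_derive x v F DF -> is_derive x v H DH ->
  is_derive x v (fun y => F y *m H y) (DF *m H x + F x *m DH).
Proof.
move=> /is_derive_mx dF /is_derive_mx dH; apply/is_derive_mx => i j.
have -> : (fun y => (F y *m H y) i j) =
    \sum_k ((fun y => F y i k) * (fun y => H y k j)).
  by apply/funext => y; rewrite fct_sumE mxE.
apply: is_derive_eq; rewrite mxE !mxE -big_split /=.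
apply: eq_bigr => k _; rewrite addrC; congr (_ + _).
exact: mulrC.
Qed.

Lemma is_derive_trmx m n (F : V -> 'M[R]_(m, n)) x v DF :
  is_derive x v F DF -> is_derive x v (fun y => (F y)^T) DF^T.
Proof.
move=> /is_derive_mx dF; apply/is_derive_mx => i j; rewrite mxE.
have -> : (fun y => (F y)^T i j) = (fun y => F y j i); last exact: dF.
by apply/funext => y; rewrite mxE.
Qed.

Lemma derive_cst_near (W : normedModType R) (F : V -> W) x v c :
  (\forall y \near x, F y = c) -> 'D_v F x = 0.
Proof. by move=> H; rewrite (@near_eq_derive _ _ _ F (cst c)) ?derive_cst. Qed.

End CkMatrix.

Section CkProjections.
Variables (R : realType) (V V' : normedModType R).

(** The derivative of [F z.1] along v is that of F along [v.1], again a map of this shape. This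
    lemma and its twin reduce joint smoothness in (p, t) to each variable separately. *)
Lemma Ck_on_fst (W : normedModType R) k (U : set V) (F : V -> W) : open U ->
  Ck_on k U F -> Ck_on k [set z : V * V' | U z.1] (fun z => F z.1).
Proof.
move=> oU; have oU' : open [set z : V * V' | U z.1].
  by apply: (@open_comp _ _ fst) => // z _; exact: cvg_fst.
elim: k F => [|k IH] F.
  move=> CF z Uz; apply: (@continuous_comp _ _ _ fst F); first exact: cvg_fst.
  exact: CF.
move=> [dF DF].
have lf (z : V * V') : differentiable (fst : V * V' -> V) z.
  by apply: linear_differentiable => y; exact: cvg_fst.
have E v (z : V * V') : U z.1 ->
    'D_v (fun z : V * V' => F z.1) z = 'D_v.1 F z.1.
  move=> Uz; have dFz := dF _ Uz.
  rewrite !deriveE //; last exact: (@differentiable_comp _ _ _ _ fst F).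
  rewrite (@diff_comp _ _ _ _ fst F) //= diff_lin // => y; exact: cvg_fst.
split=> [z Uz|v].
  by apply: (@differentiable_comp _ _ _ _ fst F) => //; exact: dF.
by apply: (eq_Ck_on oU' _ (IH _ (DF v.1))) => z Uz; rewrite E.
Qed.

Lemma Ck_on_snd (W : normedModType R) k (U : set V') (F : V' -> W) : open U ->
  Ck_on k U F -> Ck_on k [set z : V * V' | U z.2] (fun z => F z.2).
Proof.
move=> oU; have oU' : open [set z : V * V' | U z.2].
  by apply: (@open_comp _ _ snd) => // z _; exact: cvg_snd.
elim: k F => [|k IH] F.
  move=> CF z Uz; apply: (@continuous_comp _ _ _ snd F); first exact: cvg_snd.
  exact: CF.
move=> [dF DF].
have lf (z : V * V') : differentiable (snd : V * V' -> V') z.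
  by apply: linear_differentiable => y; exact: cvg_snd.
have E v (z : V * V') : U z.2 ->
    'D_v (fun z : V * V' => F z.2) z = 'D_v.2 F z.2.
  move=> Uz; have dFz := dF _ Uz.
  rewrite !deriveE //; last exact: (@differentiable_comp _ _ _ _ snd F).
  rewrite (@diff_comp _ _ _ _ snd F) //= diff_lin // => y; exact: cvg_snd.
split=> [z Uz|v].
  by apply: (@differentiable_comp _ _ _ _ snd F) => //; exact: dF.
by apply: (eq_Ck_on oU' _ (IH _ (DF v.2))) => z Uz; rewrite E.
Qed.

End CkProjections.

(** * Symmetry of second derivatives *)

Section Schwarz.
Variables (R : realType) (V : normedModType R).

Lemma MVT_line (F : V -> R) (x u : V) (h : R) : 0 < h ->
  (forall s, 0 <= s <= h -> differentiable F (s *: u + x)) ->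
  exists2 s, 0 <= s <= h & F (h *: u + x) - F x = 'D_u F (s *: u + x) * h.
Proof.
move=> h0 dF.
pose f (s : R) := F (s *: u + x).
have dl (s : R) : is_diff s (fun s : R => s *: u + x) (fun s : R => s *: u).
  have -> : (fun s : R => s *: u + x) = ( *:%R^~ u) + cst x by [].
  by apply: is_diff_eq; rewrite addr0.
have df (s : R) : 0 <= s <= h -> is_derive s 1 f ('D_u F (s *: u + x)).
  move=> /dF dFs; have ds : differentiable f s.
    by apply: (@differentiable_comp _ _ _ _ (fun s : R => s *: u + x) F).
  split; first exact: diff_derivable.
  rewrite deriveE // (@diff_comp _ _ _ _ (fun s : R => s *: u + x) F) //=.
  by rewrite diff_val scale1r deriveE.
have [s /[!in_itv]/= sh E] : exists2 c, c \in `]0, h[ &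
    f h - f 0 = 'D_u F (c *: u + x) * (h - 0).
  apply: MVT => // [s /[!in_itv]/= /andP[s0 sh]|].
    by apply: df; rewrite !ltW.
  apply: continuous_in_subspaceT => s /[!inE]/= /[!in_itv]/= sh.
  have [fs _] := df s sh.
  exact/differentiable_continuous/derivable1_diffP.
exists s; first by case/andP: sh => *; rewrite !ltW.
by move: E; rewrite /f scale0r add0r subr0.
Qed.

(** Two mean value steps: first along u for G(y) = F(hv + y) - F(y), then along v for D_u F. The
    intermediate point lies within h (|u| + |v| + 1) of x, where D_v D_u F differs from its value at
    x by at most e. *)
Lemma second_difference (F : V -> R) (U : set V) (x u v : V) : open U -> U x ->
  Ck_on 2 U F -> forall e : R, 0 < e -> \forall h \near 0^'+,
  `|F (h *: u + (h *: v + x)) - F (h *: v + x) - F (h *: u + x) + F x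
    - 'D_v ('D_u F) x * h ^+ 2| <= e * h ^+ 2.
Proof.
move=> oU Ux [dF DF] e e0.
have [dDF DDF] := DF u; have {}DDF := DDF v.
have : \forall y \near x, U y /\ `|'D_v ('D_u F) x - 'D_v ('D_u F) y| <= e.
  near=> y; split; first by near: y; exact: open_nbhs_nbhs.
  by near: y; have /cvgrPdist_le := DDF x Ux; exact.
move=> /nbhs_ballP[d /= d0 dP].
have nd (s r h : R) : 0 <= s <= h -> 0 <= r <= h ->
    h * (`|u| + `|v| + 1) < d ->
    ball x d (s *: u + (r *: v + x)).
  move=> /andP[s0 sh] /andP[r0 rh] hd; rewrite -ball_normE /=.
  rewrite addrA opprD addrCA subrr addr0 normrN.
  apply: le_lt_trans hd; apply: (le_trans (ler_normD _ _)).
  rewrite !normrZ !ger0_norm // !mulrDr mulr1.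
  rewrite -[leLHS]addr0 lerD ?(le_trans s0) //.
  by apply: lerD; apply: ler_wpM2r.
near=> h.
have h0 : 0 < h by near: h; exact: nbhs_right_gt.
have hd : h * (`|u| + `|v| + 1) < d.
  rewrite -ltr_pdivlMr ?ltr_wpDl ?addr_ge0 //.
  near: h; apply: nbhs_right_lt; rewrite divr_gt0 // ltr_wpDl ?addr_ge0 //.
have hh : 0 <= h <= h by rewrite lexx ltW.
have zh : 0 <= (0 : R) <= h by rewrite lexx ltW.
pose G y := F (h *: v + y) - F y.
have dsh (w y : V) : is_diff y (fun y => w + y) id.
  have -> : (fun y => w + y) = cst w + id by [].
  by apply: is_diff_eq; rewrite add0r.
have dG s : 0 <= s <= h -> differentiable F (h *: v + (s *: u + x)) /\
    differentiable F (s *: u + x).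
  move=> sh; split; apply: dF.
    by have [] := dP _ (nd _ _ _ sh hh hd); rewrite addrCA.
  by have [] := dP _ (nd _ _ _ sh zh hd); rewrite scale0r add0r.
have dG' s : 0 <= s <= h -> is_diff (s *: u + x) G
    (('d F (h *: v + (s *: u + x)) : V -> R) - ('d F (s *: u + x) : V -> R)).
  move=> /dG[d1 d2].
  have d3 : is_diff (s *: u + x) (fun y => F (h *: v + y))
      ('d F (h *: v + (s *: u + x))).
    have d1' := differentiableP d1.
    exact: (@is_diff_comp _ _ _ _ (fun y => h *: v + y) id F _ _ _ d1').
  have d4 := differentiableP d2.
  exact: is_diffB.
have [s sh Es] := MVT_line h0 (fun s sh => @ex_diff _ _ _ _ _ _ _ (dG' s sh)).
have [d1 d2] := dG s sh.
have Gs : 'D_u G (s *: u + x) =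
    'D_u F (h *: v + (s *: u + x)) - 'D_u F (s *: u + x).
  have dGs := dG' s sh.
  by rewrite !deriveE // diff_val.
have dDu r : 0 <= r <= h ->
    differentiable ('D_u F) (r *: v + (s *: u + x)).
  by move=> rh; have [/dDF] := dP _ (nd _ _ _ sh rh hd); rewrite addrCA.
have [r rh Er] := MVT_line h0 dDu.
have [_ Hr] := dP _ (nd _ _ _ sh rh hd).
have -> : F (h *: u + (h *: v + x)) - F (h *: v + x) - F (h *: u + x) + F x
    = 'D_v ('D_u F) (r *: v + (s *: u + x)) * h ^+ 2.
  transitivity (G (h *: u + x) - G x).
    rewrite /G (addrCA (h *: v)).
    by move: (F _) (F _) (F _) (F x) => a b c e'; ring.
  by rewrite Es Gs Er expr2 mulrA.
rewrite -mulrBl normrM distrC (ger0_norm (sqr_ge0 h)).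
apply: ler_wpM2r; first exact: sqr_ge0.
by rewrite (addrCA (r *: v)).
Unshelve. all: by end_near. Qed.

(** The second difference is symmetric in u and v. Divided by h^2 it is therefore within e / 2 of
    both mixed derivatives, for one and the same small h. *)
Lemma derive_commute (F : V -> R) (U : set V) (x u v : V) : open U -> U x ->
  Ck_on 2 U F -> 'D_u ('D_v F) x = 'D_v ('D_u F) x.
Proof.
move=> oU Ux CF; apply/eqP; rewrite -subr_eq0 -normr_eq0 eq_le normr_ge0 andbT.
apply/ler_addgt0Pl => e e0; rewrite addr0.
have e20 : 0 < e / 2 by lra.
have N := filterI (nbhs_right_gt (0 : R)) (filterI
  (second_difference u v oU Ux CF e20) (second_difference v u oU Ux CF e20)).
have [h [/= h0 [H1 H2]]] := filter_ex (N _ _).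
have h20 : 0 < h ^+ 2 by rewrite exprn_gt0.
rewrite -(ler_pM2r h20) -[X in _ * X <= _](ger0_norm (ltW h20)) -normrM.
have sw : h *: v + (h *: u + x) = h *: u + (h *: v + x) by exact: addrCA.
move: H1 H2; rewrite sw.
move: (F _) (F _) (F _) (F x) ('D_u _ x) ('D_v _ x) (h ^+ 2) => a b c d p q r.
by rewrite !ler_norml => /andP[? ?] /andP[? ?]; apply/andP; split; lra.
Qed.

End Schwarz.

Lemma derive_mx_commute (R : realType) (V : normedModType R) m n
    (F : V -> 'M[R]_(m, n)) (U : set V) (x u v : V) : open U -> U x ->
  Ck_on 2 U F -> 'D_u (fun y => 'D_v F y) x = 'D_v (fun y => 'D_u F y) x.
Proof.
move=> oU Ux CF; have CFij := (Ck_on_mxP _ _ oU).1 CF.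
have [dF DF] := CF.
have E w w' i j :
    'D_w (fun y => 'D_w' F y) x i j = 'D_w ('D_w' (fun y => F y i j)) x.
  have [d _] := DF w'.
  rewrite derive_mx; last by apply: diff_derivable; exact: d.
  rewrite mxE; apply: near_eq_derive; near=> y.
  rewrite derive_mx ?mxE //; apply: diff_derivable; apply: dF.
  by near: y; exact: open_nbhs_nbhs.
apply/matrixP => i j; transitivity ('D_u ('D_v (fun y => F y i j)) x).
  exact: E.
rewrite (derive_commute u v oU Ux (CFij i j)); symmetry; exact: E.
Unshelve. all: by end_near. Qed.

Section Jacobian.
Variables (R : realType) (m n : nat).
Implicit Types (F : 'rV[R]_m -> 'rV[R]_n) (U : set 'rV[R]_m).

Lemma diff_is_derive (V W : normedModType R) (F : V -> W) x v :
  differentiable F x -> is_derive x v F ('D_v F x).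
Proof. by move=> dF; apply/derivableP/diff_derivable. Qed.

Lemma jacobian_Ck F U k : open U -> Ck_on k.+1 U F -> Ck_on k U (jacobian F).
Proof.
move=> oU [dF DF]; apply/(Ck_on_mxP _ _ oU) => a b.
have := (Ck_on_mxP _ _ oU).1 (DF (delta_mx 0 a)) 0 b.
apply: eq_Ck_on => // x Ux.
by rewrite deriveEjacobian; [rewrite -rowE mxE|exact: dF].
Qed.

(** Near y the row [v *m jacobian F] is D_v F, so both sides are mixed second derivatives of F. *)
Lemma derive_jacobian_sym F U y u v : open U -> U y -> Ck_on 2 U F ->
  v *m 'D_u (jacobian F) y = u *m 'D_v (jacobian F) y.
Proof.
move=> oU Uy CF; have [dF _] := CF.
have [dJ _] := jacobian_Ck oU CF.
have E w w' : 'D_w (fun x => 'D_w' F x) y = w' *m 'D_w (jacobian F) y.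
  transitivity ('D_w (fun x => w' *m jacobian F x) y).
    apply: near_eq_derive; near=> x; apply: deriveEjacobian; apply: dF.
    by near: x; exact: open_nbhs_nbhs.
  have H := is_derive_mulmx (is_derive_cst w' y w) (diff_is_derive w (dJ y Uy)).
  by rewrite derive_val mul0mx add0r.
by rewrite -!E; exact: (derive_mx_commute _ _ oU Uy CF).
Unshelve. all: by end_near. Qed.

End Jacobian.

(** * Square roots of positive self-adjoint matrices *)

(* Vectors are rows: [Q] is self-adjoint for the inner product
   [u *m G *m v^T] when [Q *m G] is symmetric. *)
Definition posdef (R : realType) n (G : 'M[R]_n) : Prop :=
  G^T = G /\ forall u : 'rV[R]_n, u != 0 -> 0 < (u *m G *m u^T) 0 0.

Section Sqrt.
Variables (R : realType).

Lemma trmx11 (A : 'M[R]_1) : A^T = A.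
Proof. by apply/matrixP => i j; rewrite mxE !ord1. Qed.

Lemma posdef_eq0 n (G : 'M[R]_n) (u : 'rV_n) : posdef G ->
  (u *m G *m u^T) 0 0 <= 0 -> u = 0.
Proof.
by move=> [_ Gp] H; apply: contraTeq H => /Gp; rewrite ltNge.
Qed.

Lemma posdef_ge0 n (G : 'M[R]_n) (u : 'rV_n) : posdef G ->
  0 <= (u *m G *m u^T) 0 0.
Proof.
move=> [_ Gp]; have [->|/Gp/ltW//] := eqVneq u 0.
by rewrite !mul0mx mxE.
Qed.

Lemma posdef_unit n (G : 'M[R]_n) : posdef G -> G \in unitmx.
Proof.
move=> Gp; rewrite -row_free_unit -kermx_eq0; apply/eqP/row_matrixP => i.
rewrite row0; apply: (posdef_eq0 Gp).
by rewrite -row_mul mulmx_ker row0 mul0mx mxE.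
Qed.

Lemma sym_form n (G : 'M[R]_n) (u v : 'rV_n) : G^T = G ->
  u *m G *m v^T = v *m G *m u^T.
Proof.
by move=> Gs; rewrite -[LHS]trmx11 !trmx_mul trmxK Gs mulmxA.
Qed.

Lemma selfadjoint_shift n (G Q : 'M[R]_n) x : G^T = G -> (Q *m G)^T = Q *m G ->
  ((Q - x%:M) *m G)^T = (Q - x%:M) *m G.
Proof.
move=> Gs Qs; rewrite mulmxBl linearB /= Qs mul_scalar_mx.
by rewrite linearZ /= Gs.
Qed.

(** Row by row, the squared G-norm of M N is the G-pairing of M N N with M. This is what excludes
    Jordan blocks for self-adjoint matrices. *)
Lemma selfadjoint_square n (G N : 'M[R]_n) p (M : 'M[R]_(p, n)) : posdef G ->
  (N *m G)^T = N *m G -> M *m N *m N = 0 -> M *m N = 0.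
Proof.
move=> Gp Ns MNN; apply/row_matrixP => i; rewrite row0 row_mul.
apply: (posdef_eq0 Gp).
have -> : row i M *m N *m G *m (row i M *m N)^T
    = row i (M *m N *m N) *m G *m (row i M)^T.
  rewrite !row_mul trmx_mul !mulmxA; congr (_ *m _).
  by rewrite -!mulmxA; congr (_ *m (_ *m _)); rewrite -Ns trmx_mul Gp.1.
by rewrite MNN row0 !mul0mx mxE.
Qed.

(** The minimal polynomial splits over the complex numbers. For an eigenvector a + i b with
    eigenvalue x + i y, symmetry of the pairing of a Q with b gives y (|a|^2 + |b|^2) = 0; then a or
    b is a real eigenvector, and positivity of Q gives x > 0. *)
Lemma real_eigenvalues n (G Q : 'M[R]_n.+1) : posdef G ->
  (Q *m G)^T = Q *m G ->
  (forall u : 'rV_n.+1, u != 0 -> 0 < (u *m Q *m G *m u^T) 0 0) ->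
  exists2 rs : seq R, all (> 0) rs &
    mxminpoly Q = \prod_(r <- rs) ('X - r%:P).
Proof.
move=> Gp Qs Qp.
pose f := [the {rmorphism R -> R[i]} of real_complex R].
pose A := map_mx f Q.
have [zs zsE] := closed_field_poly_normal (mxminpoly A).
have zsE' : mxminpoly A = \prod_(z <- zs) ('X - z%:P).
  by rewrite zsE (monicP (mxminpoly_monic A)) scale1r.
have zreal z : z \in zs -> 0 < complex.Re z /\ z = (complex.Re z)%:C%C.
  move=> zzs; have : root (mxminpoly A) z by rewrite zsE' root_prod_XsubC.
  rewrite -eigenvalue_root_min => /eigenvalueP[v vA v0].
  pose a := map_mx (@complex.Re R) v; pose b := map_mx (@complex.Im R) v.
  have aQ : a *m Q = complex.Re z *: a - complex.Im z *: b.
    apply/rowP => j.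
    have := congr1 (fun w : 'rV[R[i]]_n.+1 => complex.Re (w 0 j)) vA.
    rewrite !mxE raddf_sum /= => E.
    transitivity (complex.Re (z * v 0 j)); last first.
      by case: z {zzs vA E} => x y; case: (v 0 j).
    rewrite -E; apply: eq_bigr => k _; rewrite !mxE /=.
    by case: (v 0 k) => p q /=; rewrite mulr0 subr0.
  have bQ : b *m Q = complex.Im z *: a + complex.Re z *: b.
    apply/rowP => j.
    have := congr1 (fun w : 'rV[R[i]]_n.+1 => complex.Im (w 0 j)) vA.
    rewrite !mxE raddf_sum /= => E.
    transitivity (complex.Im (z * v 0 j)).
      rewrite -E; apply: eq_bigr => k _; rewrite !mxE /=.
      by case: (v 0 k) => p q /=; rewrite mulr0 add0r.
    by case: z {zzs vA E aQ} => x y; case: (v 0 j) => p q /=; rewrite addrC.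
  set x := complex.Re z in aQ bQ *; set y := complex.Im z in aQ bQ *.
  have ab0 : (a != 0) || (b != 0).
    apply: contraNT v0; rewrite negb_or !negbK => /andP[/eqP a0 /eqP b0].
    apply/eqP/rowP => j; rewrite mxE.
    have := congr1 (fun w : 'rV_n.+1 => w 0 j) a0.
    have := congr1 (fun w : 'rV_n.+1 => w 0 j) b0.
    by rewrite !mxE; case: (v 0 j) => p q /= -> ->.
  have a2 := posdef_ge0 a Gp; have b2 := posdef_ge0 b Gp.
  have y0 : y = 0.
    have := sym_form a b Qs; rewrite !mulmxA aQ bQ.
    rewrite !(mulmxBl, mulmxDl) -!scalemxAl (sym_form b a Gp.1) addrC.
    move/eqP; rewrite -subr_eq0 opprD addrACA subrr addr0 => /eqP.
    move/(congr1 (fun w : 'M[R]_1 => w 0 0)); rewrite !mxE => E.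
    have {}E : y * ((a *m G *m a^T) 0 0 + (b *m G *m b^T) 0 0) = 0.
      by move: E; rewrite !mxE; lra.
    apply/eqP; move: E => /eqP; rewrite mulf_eq0 => /orP[//|].
    rewrite paddr_eq0 // => /andP[/eqP a0 /eqP b0].
    have {}a0 : a = 0 by apply: (posdef_eq0 Gp); rewrite a0.
    have {}b0 : b = 0 by apply: (posdef_eq0 Gp); rewrite b0.
    by move: ab0; rewrite a0 b0 eqxx.
  split; last by rewrite [LHS]complexE -/x -/y y0 mulr0 addr0.
  have pos (c : 'rV[R]_n.+1) : c != 0 -> c *m Q = x *: c -> 0 < x.
    move=> c0 cQ; have := Qp c c0; rewrite cQ -!scalemxAl mxE pmulr_lgt0 //.
    by case: Gp => _; apply.
  by case/orP: ab0 => /pos; apply; rewrite ?aQ ?bQ y0 scale0r ?subr0 ?add0r.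
exists (map (@complex.Re R) zs).
  by apply/allP => _ /mapP[z zzs ->]; have [] := zreal z zzs.
apply: (map_poly_inj f).
rewrite -mxminpoly_map -/A zsE' rmorph_prod big_map big_seq [RHS]big_seq.
apply: eq_bigr => z /zreal[_ zE] /=.
by rewrite map_polyXsubC {1}zE.
Qed.

Lemma horner_mxC n (Q : 'M[R]_n.+1) (p q : {poly R}) :
  horner_mx Q p *m horner_mx Q q = horner_mx Q q *m horner_mx Q p.
Proof. by rewrite !mulmxE -!rmorphM mulrC. Qed.

Lemma annihilate_undup n (G Q : 'M[R]_n.+1) (rs : seq R) (M : 'M[R]_n.+1) :
  posdef G -> (Q *m G)^T = Q *m G ->
  M *m horner_mx Q (\prod_(r <- rs) ('X - r%:P)) = 0 ->
  M *m horner_mx Q (\prod_(r <- undup rs) ('X - r%:P)) = 0.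
Proof.
move=> Gp Qs; elim: rs M => [//|x rs IH] M.
have NE : horner_mx Q ('X - x%:P) = Q - x%:M.
  by rewrite rmorphB /= horner_mx_X horner_mx_C.
rewrite big_cons rmorphM -mulmxE mulmxA => /IH /=.
case: ifP => [xrs|_]; last by rewrite big_cons rmorphM -mulmxE mulmxA.
(* As x is still among the roots in [undup rs], the factor N now occurs twice in H, and
   [selfadjoint_square] removes one copy. *)
rewrite (bigD1_seq x) ?undup_uniq ?mem_undup // rmorphM -mulmxE /=.
set N := horner_mx Q ('X - _) in NE *; set P := horner_mx _ _ => H.
have C : N *m P = P *m N by exact: horner_mxC.
rewrite C mulmxA NE.
apply: (selfadjoint_square Gp (selfadjoint_shift x Gp.1 Qs)).
rewrite -!NE -!mulmxA (mulmxA P) -C -(mulmxA N) -C.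
by move: H; rewrite -!mulmxA.
Qed.

Lemma interpolation (rs : seq R) (h : R -> R) : uniq rs ->
  exists q : {poly R}, forall r, r \in rs -> q.[r] = h r.
Proof.
elim: rs => [_|x rs IH /= /andP[xrs /IH[q qE]]]; first by exists 0.
pose p := \prod_(r <- rs) ('X - r%:P).
have px : p.[x] != 0 by rewrite -rootE root_prod_XsubC.
exists (q + ((h x - q.[x]) / p.[x]) *: p) => r.
rewrite inE hornerD hornerZ => /predU1P[->|rrs].
  by rewrite divfK // addrC subrK.
have /rootP -> : root p r by rewrite root_prod_XsubC.
by rewrite mulr0 addr0 qE.
Qed.

Lemma horner_selfadjoint n (G Q : 'M[R]_n.+1) (q : {poly R}) : G^T = G ->
  (Q *m G)^T = Q *m G ->
  (horner_mx Q q *m G)^T = horner_mx Q q *m G.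
Proof.
move=> Gs Qs; elim/poly_ind: q => [|q c IH].
  by rewrite rmorph0 mul0mx linear0.
rewrite rmorphD rmorphM /= horner_mx_X horner_mx_C -mulmxE.
have C : horner_mx Q q *m Q = Q *m horner_mx Q q.
  by have := horner_mxC Q q 'X; rewrite horner_mx_X.
rewrite mulmxDl linearD /= mul_scalar_mx linearZ /= Gs; congr (_ + _).
have QG : G *m Q^T = Q *m G by rewrite -Qs trmx_mul Gs.
move: (horner_mx Q q : 'M[R]_n.+1) C IH => A C AG.
have {}AG : G *m A^T = A *m G by rewrite -AG trmx_mul Gs.
by rewrite trmx_mul Gs trmx_mul mulmxA QG -(mulmxA Q) AG mulmxA C.
Qed.

(** This takes the place of diagonalization: interpolation at the roots yields the square root, and
    peeling off the factors yields the results on the Sylvester equation. *)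
Lemma selfadjoint_pos_split n (G Q : 'M[R]_n.+1) : posdef G ->
  (Q *m G)^T = Q *m G ->
  (forall u : 'rV_n.+1, u != 0 -> 0 < (u *m Q *m G *m u^T) 0 0) ->
  exists rs : seq R, [/\ uniq rs, all (> 0) rs &
    horner_mx Q (\prod_(r <- rs) ('X - r%:P)) = 0].
Proof.
move=> Gp Qs Qp; have [rs rs0 E] := real_eigenvalues Gp Qs Qp.
exists (undup rs); split; first exact: undup_uniq.
  by apply/allP => r; rewrite mem_undup => /(allP rs0).
rewrite -[LHS]mul1mx; apply: (annihilate_undup Gp Qs).
by rewrite -E mx_root_minpoly mulmx0.
Qed.

(** The root is S = T T, where T = q(Q) and q interpolates fourth roots at the eigenvalues. Fourth
    roots are taken because S G = T G T^T is then visibly positive. *)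
Lemma posdef_sqrt n (G Q : 'M[R]_n) : posdef G ->
  (Q *m G)^T = Q *m G ->
  (forall u : 'rV_n, u != 0 -> 0 < (u *m Q *m G *m u^T) 0 0) ->
  exists S : 'M[R]_n, S *m S = Q /\ posdef (S *m G).
Proof.
case: n G Q => [|n] G Q Gp Qs Qp.
  exists Q; split; first by rewrite !thinmx0.
  by split => // u; rewrite thinmx0 eqxx.
have [rs [urs rs0 ann]] := selfadjoint_pos_split Gp Qs Qp.
have [q qE] := interpolation (fun r => Num.sqrt (Num.sqrt r)) urs.
pose T := horner_mx Q q.
have T4 : T *m T *m (T *m T) = Q.
  (* The polynomial q^4 - X vanishes at the distinct roots, so it is a multiple of the product that
     annihilates Q. *)
  have : (\prod_(r <- rs) ('X - r%:P)) %| q ^+ 2 ^+ 2 - 'X.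
    apply: uniq_roots_dvdp; last by rewrite uniq_rootsE.
    apply/allP => r rrs.
    rewrite rootE hornerD hornerN !horner_exp hornerX qE //.
    by rewrite !sqr_sqrtr ?sqrtr_ge0 ?subrr // ltW //; exact: (allP rs0).
  move=> /dvdpP[p pE].
  have /eqP : horner_mx Q (q ^+ 2 ^+ 2 - 'X) = 0.
    by rewrite pE rmorphM /= ann mulr0.
  rewrite rmorphB /= horner_mx_X subr_eq0 => /eqP <-.
  by rewrite !expr2 !rmorphM /= -!mulmxE.
have Ts : (T *m G)^T = T *m G by exact: horner_selfadjoint Gp.1 Qs.
have TG : G *m T^T = T *m G by rewrite -Ts trmx_mul Gp.1.
have TTG : T *m T *m G = T *m G *m T^T by rewrite -!mulmxA TG.
exists (T *m T); split => //; split.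
  by rewrite TTG !trmx_mul trmxK Gp.1 mulmxA.
move=> u u0; rewrite TTG !mulmxA -(mulmxA _ T^T) -trmx_mul.
case: Gp => _; apply; apply: contraTneq (Qp u u0) => uT0.
by rewrite -T4 !mulmxA uT0 !mul0mx mxE ltxx.
Qed.

(** Induction on the linear factors of S that annihilate E. The matrix (S - r) E solves the same
    equation with one factor fewer, so it vanishes; then E T = - r E with r > 0, which T >= 0 allows
    only for E = 0. *)
Lemma sylvester_eq0 n (G S T E : 'M[R]_n) : posdef G -> posdef (S *m G) ->
  (forall u : 'rV_n, 0 <= (u *m T *m G *m u^T) 0 0) ->
  S *m E + E *m T = 0 -> E = 0.
Proof.
case: n G S T E => [|n] G S T E Gp Sp Tp; first by rewrite !thinmx0.
have SGp (u : 'rV_n.+1) : u != 0 -> 0 < (u *m S *m G *m u^T) 0 0.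
  by rewrite -(mulmxA u); exact: Sp.2.
have [rs [_ rs0 ann]] := selfadjoint_pos_split Gp Sp.1 SGp.
have : horner_mx S (\prod_(r <- rs) ('X - r%:P)) *m E = 0.
  by rewrite ann mul0mx.
elim: rs rs0 E {ann} => [_ E|r rs IH /= /andP[r0 /IH {}IH] E].
  by rewrite big_nil rmorph1 mul1mx.
have NE : horner_mx S ('X - r%:P) = S - r%:M.
  by rewrite rmorphB /= horner_mx_X horner_mx_C.
rewrite big_cons mulrC rmorphM -mulmxE -mulmxA /= NE => H SET.
have E1 : (S - r%:M) *m E = - (E *m (T + r%:M)).
  rewrite mulmxBl mulmxDr opprD mul_scalar_mx mul_mx_scalar; congr (_ - _).
  by apply/eqP; rewrite -addr_eq0 SET.
have F0 : (S - r%:M) *m E = 0.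
  apply: (IH _ H).
  have -> : S *m ((S - r%:M) *m E) = (S - r%:M) *m (S *m E).
    by rewrite !mulmxA mulmxBl mulmxBr scalar_mxC.
  by rewrite -(mulmxA _ E) -mulmxDr SET mulmx0.
apply/row_matrixP => i; rewrite row0; apply: (posdef_eq0 Gp).
have : row i E *m (T + r%:M) = 0.
  by rewrite -row_mul -[X in row i X]opprK -E1 F0 oppr0 row0.
rewrite mulmxDr mul_mx_scalar => /eqP; rewrite addr_eq0 => /eqP ET.
have := Tp (row i E); rewrite ET mulNmx mulNmx -!scalemxAl !mxE oppr_ge0.
by rewrite pmulr_rle0.
Qed.
End Sqrt.

Section MatrixNorm.
Variables (R : realType).

Lemma mx_entry_norm m n (A : 'M[R]_(m, n)) i j : `|A i j| <= `|A|.
Proof.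
rewrite [leRHS]/Num.Def.normr /= mx_normrE.
exact: (le_bigmax _ (fun ij : 'I_m * 'I_n => `|A ij.1 ij.2|) (i, j)).
Qed.

Lemma mx_norm_le m n (A : 'M[R]_(m, n)) (c : R) : 0 <= c ->
  (forall i j, `|A i j| <= c) -> `|A| <= c.
Proof.
move=> c0 H; rewrite [leLHS]/Num.Def.normr /= mx_normrE.
by apply: bigmax_le => // -[i j] _.
Qed.

Lemma mulmx_norm m n p (A : 'M[R]_(m, n)) (B : 'M[R]_(n, p)) :
  `|A *m B| <= n%:R * (`|A| * `|B|).
Proof.
apply: mx_norm_le => [|i j]; first by rewrite !mulr_ge0.
rewrite mxE (le_trans (ler_norm_sum _ _ _)) //.
have -> : n%:R * (`|A| * `|B|) = \sum_(k < n) (`|A| * `|B|).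
  by rewrite sumr_const card_ord mulr_natl.
rewrite ler_sum // => k _.
by rewrite normrM ler_pM // mx_entry_norm.
Qed.

Lemma mulmx_entry m n p (A : 'M[R]_(m, n)) (B : 'M[R]_(n, p)) i j :
  (A *m B) i j = (row i A *m col j B) 0 0.
Proof. by rewrite !mxE; apply: eq_bigr => k _; rewrite !mxE. Qed.

Lemma posdef_CauchySchwarz n (G : 'M[R]_n) (u v : 'rV_n) : posdef G ->
  ((u *m G *m v^T) 0 0) ^+ 2 <= (u *m G *m u^T) 0 0 * (v *m G *m v^T) 0 0.
Proof.
move=> Gp; have [->|v0] := eqVneq v 0.
  by rewrite !linear0 !mxE expr0n mulr0.
set b := (u *m G *m v^T) 0 0; set c := (v *m G *m v^T) 0 0.
have c0 : 0 < c by exact: Gp.2.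
have := posdef_ge0 (c *: u - b *: v) Gp.
have -> : (c *: u - b *: v)^T = c *: u^T - b *: v^T.
  by rewrite linearB !linearZ.
rewrite !mulmxBl !mulmxBr -!scalemxAl -!scalemxAr (sym_form v u Gp.1).
move: @b @c c0; move: (u *m G *m u^T) (u *m G *m v^T) (v *m G *m v^T).
move=> A1 B1 C1 b c c0; rewrite !mxE -/b -/c; set a := A1 0 0.
have -> : c * (c * a) - c * (b * b) - (b * (c * b) - b * (b * c))
    = c * (a * c - b ^+ 2) by ring.
by rewrite pmulr_rge0 // subr_ge0.
Qed.

Lemma posdef_invmx n (G : 'M[R]_n) : posdef G -> posdef (invmx G).
Proof.
move=> Gp; have Gu := posdef_unit Gp; have Hs : (invmx G)^T = invmx G.
  by rewrite trmx_inv Gp.1.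
split => // u u0.
have -> : u *m invmx G *m u^T = (u *m invmx G) *m G *m (u *m invmx G)^T.
  by rewrite trmx_mul Hs mulmxKV // mulmxA.
apply: Gp.2; apply: contra_neq u0 => H.
by rewrite -[u](mulmxKV Gu) H mul0mx.
Qed.

(* Cauchy-Schwarz for the inner product of matrix [G^-1] on columns. *)
Lemma shift_entry_bound n (G S Z : 'M[R]_n) (r : R) k j : posdef G ->
  posdef (S *m G) -> 0 < r ->
  (Z k j) ^+ 2 <= G k k *
    (((S + r%:M) *m Z)^T *m invmx G *m ((S + r%:M) *m Z)) j j / r ^+ 2.
Proof.
move=> Gp Sp r0; set X := _ *m Z.
have Gu := posdef_unit Gp; have Hp := posdef_invmx Gp.
set H := invmx G in Hp *.
pose z := (col j Z)^T; pose x := (col j X)^T.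
have xE : x^T = S *m z^T + r *: z^T.
  by rewrite /x /z !trmxK !colE /X -mulmxA mulmxDl mul_scalar_mx.
set c := (_ *m X) j j.
have cE : c = (x *m H *m x^T) 0 0.
  by rewrite /c /x trmxK tr_col -row_mul mulmx_entry.
set a := (z *m H *m z^T) 0 0.
have a0 : 0 <= a by exact: posdef_ge0.
(* S is positive for the inner product G^-1, so pairing z with x = (S + r) z gives at least r |z|^2;
   Cauchy-Schwarz then yields r |z| <= |x|. *)
have b_ge : r * a <= (z *m H *m x^T) 0 0.
  rewrite xE mulmxDr -scalemxAr mxE [X in _ + X]mxE -/a lerDr.
  have -> : z *m H *m (S *m z^T) = (z *m H) *m (S *m G) *m (z *m H)^T.
    by rewrite trmx_mul Hp.1 !mulmxA mulmxK.
  exact: posdef_ge0.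
have bac := posdef_CauchySchwarz z x Hp; rewrite -/a -cE in bac.
have ac : a <= c / r ^+ 2.
  have [->|an0] := eqVneq a 0.
    by rewrite divr_ge0 ?sqr_ge0 // cE posdef_ge0.
  have agt : 0 < a by rewrite lt_def an0.
  rewrite ler_pdivlMr ?exprn_gt0 // -(ler_pM2l agt); apply: le_trans bac.
  have -> : a * (a * r ^+ 2) = (r * a) ^+ 2 by ring.
  have ra0 : 0 <= r * a by rewrite mulr_ge0 // ltW.
  by rewrite ler_sqr ?nnegrE // (le_trans ra0 b_ge).
pose e : 'rV[R]_n := delta_mx 0 k.
have eG : (e *m G *m e^T) 0 0 = G k k.
  by rewrite -rowE trmx_delta -colE !mxE.
have e0 : e *m G *m H *m (e *m G)^T = e *m G *m e^T.
  by rewrite mulmxK // trmx_mul Gp.1 mulmxA.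
have ZE : Z k j = (e *m G *m H *m z^T) 0 0.
  by rewrite mulmxK // -rowE !mxE.
have := posdef_CauchySchwarz (e *m G) z Hp.
rewrite -ZE e0 -/a eG => /le_trans; apply.
by rewrite -mulrA ler_wpM2l // -eG posdef_ge0.
Qed.

End MatrixNorm.

Section LinearMatrix.
Variables (R : realType) (V : normedModType R).

Lemma Ck_on_linear k (U : set V) m n p q
    (f : {linear 'M[R]_(m, n) -> 'M[R]_(p, q)}) (F : V -> 'M[R]_(m, n)) :
  open U -> Ck_on k U F -> Ck_on k U (fun x => f (F x)).
Proof.
move=> oU /(Ck_on_mxP _ _ oU) CF.
have C : Ck_on k U
    (fun x => \sum_i \sum_j F x i j *: (f (delta_mx i j) : 'M[R]_(p, q))).
  do 2 (apply: Ck_on_sum => // ? _).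
  by apply: Ck_on_scale => //; exact: Ck_on_cst.
apply: (eq_Ck_on oU _ C) => x _.
rewrite [in RHS](matrix_sum_delta (F x)) linear_sum; apply: eq_bigr => i _.
by rewrite linear_sum; apply: eq_bigr => j _; rewrite linearZ.
Qed.

End LinearMatrix.

Section ShiftNorm.
Variables (R : realType) (V : normedModType R) (n : nat) (U : set V).
Variables (G S : V -> 'M[R]_n).
Hypothesis (oU : open U).
Hypothesis (cG : Ck_on 0 U G).
Hypothesis (Gp : forall x, U x -> posdef (G x)).
Hypothesis (Sp : forall x, U x -> posdef (S x *m G x)).

(** The bound must be uniform in y although continuity of S is not yet known. S y enters only
    through its positivity; the constant depends on r and on bounds for G and G^-1 near x. *)
Lemma shift_norm x r : U x -> 0 < r -> exists2 C : R, 0 <= C &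
  \forall y \near x, forall Z : 'M[R]_n, `|Z| <= C * `|(S y + r%:M) *m Z|.
Proof.
move=> Ux r0.
have cH : Ck_on 0 U (fun y => invmx (G y)).
  by apply: Ck_on_invmx => // y /Gp /posdef_unit.
pose g := `|G x| + 1; pose h := `|invmx (G x)| + 1.
have near_norm (F : V -> 'M[R]_n) : {for x, continuous F} ->
    \forall y \near x, `|F y| <= `|F x| + 1.
  move=> /cvgrPdist_le /(_ _ ltr01); apply: filterS => y.
  rewrite distrC => Fy; rewrite -lerBlDl; exact: le_trans (lerB_dist _ _) Fy.
(* Here g bounds the diagonal entries of G y, and n (n h) |X|^2 bounds the entries of X^T G^-1 X. *)
pose K := g * (n%:R * (n%:R * h)) / r ^+ 2.
exists (Num.sqrt K); first exact: sqrtr_ge0.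
near=> y => Z.
have Uy : U y by near: y; exact: open_nbhs_nbhs.
have gy : `|G y| <= g by near: y; apply: near_norm; exact: cG.
have hy : `|invmx (G y)| <= h.
  by near: y; apply: (near_norm (fun y => invmx (G y))); exact: cH.
apply: mx_norm_le => [|k j]; first by rewrite mulr_ge0 ?sqrtr_ge0.
have := shift_entry_bound Z k j (Gp Uy) (Sp Uy) r0.
set X := _ *m Z => B.
have g0 : 0 <= g by rewrite addr_ge0.
have h0 : 0 <= h by rewrite addr_ge0.
have XT : `|X^T| <= `|X|.
  by apply: mx_norm_le => // a b; rewrite mxE mx_entry_norm.
have K0 : 0 <= K.
  by apply: divr_ge0; [do 3?[apply: mulr_ge0 => //]|exact: sqr_ge0].
have -> : `|Z k j| = Num.sqrt (Z k j ^+ 2) by rewrite sqrtr_sqr.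
have -> : Num.sqrt K * `|X| = Num.sqrt (K * `|X| ^+ 2).
  by rewrite (sqrtrM _ K0) sqrtr_sqr ger0_norm.
apply: ler_wsqrtr; apply: le_trans B _.
have Gk : G y k k <= g.
  by apply: le_trans gy; apply: le_trans (mx_entry_norm _ k k); exact: ler_norm.
set T := X^T *m _ *m X.
have TE : `|T j j| <= n%:R * (n%:R * h) * `|X| ^+ 2.
  apply: (le_trans (mx_entry_norm _ _ _)); apply: (le_trans (mulmx_norm _ _)).
  rewrite -mulrA ler_wpM2l // expr2 mulrA ler_wpM2r //.
  apply: (le_trans (mulmx_norm _ _)); rewrite -mulrA ler_wpM2l //.
  by rewrite mulrC ler_pM.
rewrite /K [leRHS]mulrAC ler_wpM2r ?invr_ge0 ?sqr_ge0 //.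
have T0 : 0 <= T j j.
  have := posdef_ge0 (col j X)^T (posdef_invmx (Gp Uy)).
  by rewrite trmxK tr_col -row_mul -mulmx_entry.
rewrite -mulrA; apply: le_trans (_ : g * T j j <= _).
  by rewrite ler_wpM2r.
by rewrite ler_wpM2l //; apply: le_trans TE; exact: ler_norm.
Unshelve. all: by end_near. Qed.

End ShiftNorm.

Section SmoothSqrt.
Variables (R : realType) (V : normedModType R).

(* With E' = E (A - r), one has (S + r) E = (S E + E A) - E', and
   S E' + E' A = (S E + E A) (A - r): peel off one linear factor at a time. *)
Lemma sylvester_norm_aux n (U : set V) (G S : V -> 'M[R]_n.+1) (A : 'M[R]_n.+1)
    (rs : seq R) x : open U ->
  Ck_on 0 U G -> (forall x, U x -> posdef (G x)) ->
  (forall x, U x -> posdef (S x *m G x)) -> U x -> all (> 0) rs ->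
  exists2 C : R, 0 <= C & \forall y \near x, forall E : 'M[R]_n.+1,
    E *m horner_mx A (\prod_(r <- rs) ('X - r%:P)) = 0 ->
    `|E| <= C * `|S y *m E + E *m A|.
Proof.
move=> oU cG Gp Sp Ux; elim: rs => [_|r rs IH /= /andP[r0 /IH[C C0 HC]]].
  exists 0 => //; near=> y => E; rewrite big_nil rmorph1 mulmx1 => ->.
  by rewrite normr0 mul0r.
have [C' C'0 HC'] := shift_norm oU cG Gp Sp Ux r0.
pose c := n.+1%:R * `|A - r%:M|.
exists (C' * (1 + C * c)).
  by rewrite mulr_ge0 // addr_ge0 // mulr_ge0 // mulr_ge0.
near=> y => E; set X := S y *m E + _ => EA.
pose E' := E *m (A - r%:M).
have E'A : E' *m horner_mx A (\prod_(r <- rs) ('X - r%:P)) = 0.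
  rewrite /E' -mulmxA -EA; congr (_ *m _).
  by rewrite big_cons rmorphM /= rmorphB /= horner_mx_X horner_mx_C mulmxE.
have X' : S y *m E' + E' *m A = X *m (A - r%:M).
  have cA : (A - r%:M) *m A = A *m (A - r%:M).
    by rewrite mulmxBl mulmxBr scalar_mxC.
  by rewrite /E' mulmxDl -!mulmxA cA.
have E'n : `|E'| <= C * c * `|X|.
  have Hy : forall E : 'M[R]_n.+1,
      E *m horner_mx A (\prod_(r <- rs) ('X - r%:P)) = 0 ->
      `|E| <= C * `|S y *m E + E *m A| by near: y.
  apply: le_trans (Hy _ E'A) _.
  rewrite X' -mulrA ler_wpM2l // (le_trans (mulmx_norm _ _)) //.
  by rewrite /c -mulrA ler_wpM2l // mulrC.
have SE : (S y + r%:M) *m E = X - E'.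
  rewrite /X /E' mulmxDl mulmxBr mul_mx_scalar mul_scalar_mx opprB.
  by rewrite addrA (addrAC (S y *m E)) addrK.
have Hy : forall Z : 'M[R]_n.+1, `|Z| <= C' * `|(S y + r%:M) *m Z| by near: y.
apply: le_trans (Hy E) _; rewrite SE -mulrA ler_wpM2l // mulrDl mul1r.
by apply: le_trans (ler_normB _ _) _; rewrite lerD2l.
Unshelve. all: by end_near. Qed.

(** The linear factors come from the fixed matrix [S x] on the right, so neither their number nor
    the constant depends on y. *)
Lemma sylvester_norm n (U : set V) (G S : V -> 'M[R]_n) x : open U ->
  Ck_on 0 U G -> (forall x, U x -> posdef (G x)) ->
  (forall x, U x -> posdef (S x *m G x)) -> U x ->
  exists2 C : R, 0 <= C & \forall y \near x, forall E : 'M[R]_n,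
    `|E| <= C * `|S y *m E + E *m S x|.
Proof.
case: n G S => [|n] G S oU cG Gp Sp Ux.
  by exists 0 => //; near=> y => E; rewrite [E]thinmx0 normr0 mul0r.
have SGp (u : 'rV_n.+1) : u != 0 -> 0 < (u *m S x *m G x *m u^T) 0 0.
  by rewrite -(mulmxA u); exact: (Sp x Ux).2.
have [rs [_ rs0 ann]] := selfadjoint_pos_split (Gp x Ux) (Sp x Ux).1 SGp.
have [C C0 HC] := sylvester_norm_aux (S x) oU cG Gp Sp Ux rs0.
exists C => //; apply: filterS HC => y HC E; apply: HC.
by rewrite ann mulmx0.
Unshelve. all: by end_near. Qed.

(** Written as a matrix on vectorized E, so that the inverse operator is a matrix inverse and
    depends smoothly on S by [Ck_on_invmx]. *)
Definition sylvester_mx n (S : 'M[R]_n) : 'M[R]_(n * n) :=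
  lin_mulmx S + lin_mulmxr S.

Lemma mxvec_sylvester n (S E : 'M[R]_n) :
  mxvec E *m sylvester_mx S = mxvec (S *m E + E *m S).
Proof. by rewrite mulmxDr !mul_vec_lin linearD. Qed.

Lemma sylvester_unit n (G S : 'M[R]_n) : posdef G -> posdef (S *m G) ->
  sylvester_mx S \in unitmx.
Proof.
move=> Gp Sp; rewrite -row_free_unit -kermx_eq0; apply/eqP/row_matrixP => i.
rewrite row0 -[row i _]vec_mxK; set E := vec_mx _.
suff -> : E = 0 by rewrite linear0.
apply: (sylvester_eq0 Gp Sp) => [u|].
  by rewrite -(mulmxA u); exact: (posdef_ge0 u Sp).
apply: (can_inj mxvecK); rewrite -mxvec_sylvester /E vec_mxK linear0.
by rewrite -row_mul mulmx_ker row0.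
Qed.

Section Smooth.
Variables (n : nat) (U : set V) (G Q S : V -> 'M[R]_n).
Hypotheses (oU : open U) (cG : Ck_on 0 U G).
Hypothesis (Gp : forall x, U x -> posdef (G x)).
Hypothesis (Sp : forall x, U x -> posdef (S x *m G x)).
Hypothesis (SQ : forall x, U x -> S x *m S x = Q x).

Lemma sqrtmx_continuous : Ck_on 0 U Q -> Ck_on 0 U S.
Proof.
move=> cQ x Ux; apply/cvgrPdist_le => e e0.
have [C C0 HC] := sylvester_norm oU cG Gp Sp Ux.
have C1 : 0 < C + 1 by rewrite ltr_wpDl.
have e1 : 0 < e / (C + 1) by rewrite divr_gt0.
near=> y.
have Uy : U y by near: y; exact: open_nbhs_nbhs.
have Qy : `|Q x - Q y| <= e / (C + 1).
  by near: y; have /cvgrPdist_le := cQ x Ux; exact.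
have Hy : forall E : 'M[R]_n, `|E| <= C * `|S y *m E + E *m S x| by near: y.
rewrite distrC; apply: le_trans (Hy _) _.
rewrite mulmxBr mulmxBl addrA subrK !SQ // distrC.
rewrite -[e](divfK (lt0r_neq0 C1)) [leRHS]mulrC ler_pM // lerDl //.
Unshelve. all: by end_near. Qed.

(** Differentiating S S = Q suggests the solution D of S D + D S = dQ. With y = x + h, the error E =
    S_y - S_x - D h satisfies S_y E + E S_x = (Q_y - Q_x - dQ h) + (S_x - S_y) D h. Both terms are
    o(h), the second by continuity of S, and [sylvester_norm] carries this over to E. *)
Lemma sqrtmx_differentiable x : Ck_on 0 U Q -> U x -> differentiable Q x ->
  differentiable S x /\ forall v,
  'D_v S x = vec_mx (mxvec ('D_v Q x) *m invmx (sylvester_mx (S x))).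
Proof.
move=> cQ Ux dQ; have cS := sqrtmx_continuous cQ.
pose iL := invmx (sylvester_mx (S x)).
pose D (h : V) : 'M[R]_n := vec_mx (mxvec ('d Q x h) *m iL).
have Dlin : linear D.
  by move=> a u v; rewrite /D !linearP mulmxDl -scalemxAl !linearP.
have Dc : continuous D.
  have cD : Ck_on 0 setT D.
    apply: (Ck_on_linear vec_mx); first exact: openT.
    apply: Ck_on_mulmx; [exact: openT| |exact: Ck_on_cst].
    apply: (Ck_on_linear mxvec); first exact: openT.
    by move=> y _; exact: diff_continuous.
  by move=> h; exact: cD.
have DE h : S x *m D h + D h *m S x = 'd Q x h.
  apply: (can_inj mxvecK); rewrite -mxvec_sylvester /D vec_mxK mulmxKV //.
  exact: sylvester_unit (Gp Ux) (Sp Ux).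
suff [dS SE] : differentiable S x /\ forall v, 'D_v S x = D v.
  by split => // v; rewrite SE /D deriveE.
apply: differentiable_eps => // e e0.
pose D' : {linear V -> 'M[R]_n} :=
  HB.pack D (@GRing.isLinear.Build _ _ _ _ D Dlin).
have [k k0 Hk] := @linear_lipschitz _ _ _ D' Dc.
have [C C0 HC] := sylvester_norm oU cG Gp Sp Ux.
have C1 : 0 < C + 1 by rewrite ltr_wpDl.
have n1 : 0 < n%:R + 1 :> R by rewrite ltr_wpDl.
(* Each of the two error terms is to contribute e / 2 |h|; the added ones keep the denominators
   positive. *)
pose e1 := e / (2 * (C + 1)); pose e2 := e / (2 * (C + 1) * (n%:R + 1) * k).
have e10 : 0 < e1 by rewrite divr_gt0 ?mulr_gt0.
have e20 : 0 < e2 by rewrite divr_gt0 ?mulr_gt0.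
have sc : (fun h => h + x) @ (0 : V) --> x.
  by rewrite -{2}(add0r x); apply: cvgD; [exact: cvg_id|exact: cvg_cst].
near=> h.
have Uy : U (h + x) by near: h; apply: sc; exact: open_nbhs_nbhs.
have Hy : forall E : 'M[R]_n, `|E| <= C * `|S (h + x) *m E + E *m S x|.
  by near: h; exact: (sc _ HC).
have Sy : `|S x - S (h + x)| <= e2.
  near: h; apply: (sc [set y | `|S x - S y| <= e2]).
  by have /cvgrPdist_le := cS x Ux; exact.
have Qy : `|Q (h + x) - Q x - 'd Q x h| <= e1 * `|h|.
  by near: h; exact: differentiable_near0.
apply: le_trans (Hy _) _.
set Z := _ + _ in |- *.
have -> : Z = (Q (h + x) - Q x - 'd Q x h) + (S x - S (h + x)) *m D h.
  rewrite /Z -DE -!SQ // !mulmxBr !mulmxBl.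
  move: (S (h + x)) (S x) (D h) => a b d.
  apply/matrixP => i j; rewrite !mxE; ring.
have Sn : `|(S x - S (h + x)) *m D h| <= n%:R * (e2 * (k * `|h|)).
  apply: le_trans (mulmx_norm _ _) _; rewrite ler_wpM2l // ler_pM //.
apply: (@le_trans _ _ ((C + 1) * (e1 * `|h| + (n%:R + 1) * (e2 * (k * `|h|))))).
  apply: ler_pM => //; first by rewrite lerDl.
  apply: le_trans (ler_normD _ _) _; apply: lerD => //; apply: le_trans Sn _.
  apply: ler_wpM2r; last by rewrite lerDl.
  by apply: mulr_ge0; [exact: ltW|apply: mulr_ge0 => //; exact: ltW].
rewrite le_eqVlt; apply/orP; left; apply/eqP; rewrite /e1 /e2.
by field; rewrite !lt0r_neq0.
Unshelve. all: by end_near. Qed.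

(** Bootstrap: the formula for D_v S involves S only undifferentiated, so S of class C^k makes D_v S
    of class C^k. *)
Lemma sqrtmx_smooth : (forall k, Ck_on k U Q) -> forall k, Ck_on k U S.
Proof.
move=> CQ; elim=> [|k IH]; first exact: sqrtmx_continuous.
have [dQ DQ] := CQ k.+1.
have sd x (Ux : U x) := sqrtmx_differentiable (CQ 0%N) Ux (dQ x Ux).
split=> [x /sd[]//|v].
have C : Ck_on k U
    (fun x => vec_mx (mxvec ('D_v Q x) *m invmx (sylvester_mx (S x)))).
  apply: (Ck_on_linear vec_mx) => //; apply: Ck_on_mulmx => //.
    exact: (Ck_on_linear mxvec oU (DQ v)).
  apply: Ck_on_invmx => // [x Ux|].
    exact: sylvester_unit (Gp Ux) (Sp Ux).
  apply: Ck_on_add => //.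
    exact: (Ck_on_linear lin_mulmx oU IH).
  exact: (Ck_on_linear lin_mulmxr oU IH).
by apply: (eq_Ck_on oU _ C) => x /sd[_ ->].
Qed.

End Smooth.

End SmoothSqrt.

(** * Charts *)

Section Charts.
Variables (R : realType) (m : nat) (M : smooth_manifold R m).
Implicit Types (i j l : chart_idx M) (k : nat) (p q : M) (x y : 'rV[R]_m).

Definition chart_image i : set 'rV[R]_m := coord i @` cdom i.

Lemma chart_imageP i y : chart_image i y ->
  cdom i (param i y) /\ coord i (param i y) = y.
Proof. by move=> [p ip <-]; rewrite coordK. Qed.

Lemma chart_at_dom p : cdom (chart_at p) p.
Proof. by rewrite /chart_at; case: cid. Qed.

Lemma open_chart_image i : open (chart_image i).
Proof. exact: cim_open. Qed.

Lemma open_coord_image i (W : set M) : open W ->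
  open (coord i @` (cdom i `&` W)).
Proof.
move=> oW; rewrite openE => y [p [ip Wp] <-].
have Ip : chart_image i (coord i p) by exists p.
have cp := @param_continuous _ _ M i _ Ip.
have : nbhs (coord i p) (chart_image i `&` (param i @^-1` (W `&` cdom i))).
  apply: filterI.
    by apply: open_nbhs_nbhs; split => //; exact: open_chart_image.
  apply: cp; rewrite coordK //; apply: open_nbhs_nbhs; split => //.
  exact: openI oW (cdom_open i).
apply: filterS => z [Iz [Wz iz]]; exists (param i z) => //.
by have [] := chart_imageP Iz.
Qed.

(* Locked, since unification would otherwise unfold Jacobians. *)
Definition trans i j x : 'M[R]_m := locked (jacobian (coord j \o param i) x).

Lemma transE i j x : trans i j x = jacobian (coord j \o param i) x.
Proof. by rewrite /trans -lock. Qed.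

Definition overlap i j : set 'rV[R]_m := coord i @` (cdom i `&` cdom j).

Lemma open_overlap i j : open (overlap i j).
Proof. exact: (@open_coord_image i _ (cdom_open j)). Qed.
Arguments open_overlap i j : clear implicits.

Lemma mem_overlap i j p : cdom i p -> cdom j p -> overlap i j (coord i p).
Proof. by move=> ip jp; exists p. Qed.

Lemma overlap_param i j x : overlap i j x ->
  [/\ cdom i (param i x), cdom j (param i x) & coord i (param i x) = x].
Proof. by move=> [p [ip jp] <-]; rewrite coordK. Qed.

Lemma transition_Ck i j k :
  Ck_on k (overlap i j) (fun x => coord j (param i x)).
Proof. exact: transition_smooth. Qed.

Lemma transition_diff i j x : overlap i j x ->
  differentiable (coord j \o param i) x.
Proof. by have [d _] := transition_Ck i j 1; exact: d. Qed.

Lemma derive_transition i j x v : overlap i j x ->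
  'D_v (coord j \o param i) x = v *m trans i j x.
Proof.
by move=> ijx; rewrite transE deriveEjacobian //; exact: transition_diff.
Qed.

Lemma trans_Ck i j k : Ck_on k (overlap i j) (trans i j).
Proof.
suff -> : trans i j = jacobian (coord j \o param i).
  exact: jacobian_Ck (open_overlap i j) (transition_Ck i j k.+1).
by apply/funext => x; rewrite transE.
Qed.

Lemma coframeE j p : coframe j p = trans (chart_at p) j (coord (chart_at p) p).
Proof. by rewrite transE. Qed.

Lemma frameE i p : frame i p = trans i (chart_at p) (coord i p).
Proof. by rewrite transE. Qed.

Lemma near_overlap i j p : cdom i p -> cdom j p ->
  \forall x \near coord i p, overlap i j x.
Proof.
move=> ip jp; apply: open_nbhs_nbhs; split; first exact: open_overlap.
exact: mem_overlap.
Qed.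

Lemma trans_id i p : cdom i p -> trans i i (coord i p) = 1%:M.
Proof.
move=> ip; apply/row_matrixP => a; rewrite !rowE mulmx1.
rewrite -derive_transition; last exact: mem_overlap.
rewrite -[RHS](derive_id (coord i p)); apply: near_eq_derive; near=> x.
have ix : overlap i i x by near: x; exact: near_overlap.
by rewrite /=; have [_ _ ->] := overlap_param ix.
Unshelve. all: by end_near. Qed.

Lemma trans_comp i j l p : cdom i p -> cdom j p -> cdom l p ->
  trans i j (coord i p) *m trans j l (coord j p) = trans i l (coord i p).
Proof.
move=> ip jp lp; apply/row_matrixP => a; rewrite !rowE mulmxA.
set x := coord i p; have xE : coord j p = (coord j \o param i) x.
  by rewrite /= coordK.
set v := delta_mx 0 a.
transitivity ('D_v ((coord l \o param j) \o (coord j \o param i)) x).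
  have dj : differentiable (coord l \o param j) ((coord j \o param i) x).
    by rewrite -xE; apply/transition_diff/mem_overlap.
  have di := transition_diff (mem_overlap ip jp).
  rewrite (derive_comp_rV v di dj) -xE.
  rewrite (derive_transition v (mem_overlap ip jp)).
  by rewrite (derive_transition _ (mem_overlap jp lp)).
rewrite -[RHS](derive_transition v (mem_overlap ip lp)).
apply: near_eq_derive; near=> y.
have ijy : overlap i j y by near: y; exact: near_overlap.
by have [_ jy _] := overlap_param ijy; rewrite /= coordK.
Unshelve. all: by end_near. Qed.

Lemma frame_coframe i j p : cdom i p -> cdom j p ->
  frame i p *m coframe j p = trans i j (coord i p).
Proof.
by move=> ip jp; rewrite frameE coframeE trans_comp //; exact: chart_at_dom.
Qed.

Lemma frameK i p : cdom i p -> frame i p *m coframe i p = 1%:M.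
Proof. by move=> ip; rewrite frame_coframe // trans_id. Qed.

Lemma coframeK i p : cdom i p -> coframe i p *m frame i p = 1%:M.
Proof. by move=> ip; apply: mulmx1C; exact: frameK. Qed.

Lemma coframe_chart_at p : coframe (chart_at p) p = 1%:M.
Proof. by rewrite coframeE trans_id //; exact: chart_at_dom. Qed.

Lemma frame_chart_at p : frame (chart_at p) p = 1%:M.
Proof. by rewrite frameE trans_id //; exact: chart_at_dom. Qed.

Lemma coframe_trans i j p : cdom i p -> cdom j p ->
  coframe j p = coframe i p *m trans i j (coord i p).
Proof.
by move=> ip jp; rewrite -frame_coframe // mulmxA coframeK // mul1mx.
Qed.

Lemma vrep_coord i X p : cdom i p -> vrep i X (coord i p) = X p *m coframe i p.
Proof. by move=> ip; rewrite /vrep coordK. Qed.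

Lemma vrep_chart_at X p : vrep (chart_at p) X (coord (chart_at p) p) = X p.
Proof.
by rewrite vrep_coord ?coframe_chart_at ?mulmx1 //; exact: chart_at_dom.
Qed.

Lemma endorep_chart_at (A : endofield M) p :
  endorep (chart_at p) A (coord (chart_at p) p) = A p.
Proof.
rewrite /endorep coordK; last exact: chart_at_dom.
by rewrite frame_chart_at coframe_chart_at mul1mx mulmx1.
Qed.

Lemma bilrep_chart_at (g : bilfield M) p :
  bilrep (chart_at p) g (coord (chart_at p) p) = g p.
Proof.
rewrite /bilrep coordK; last exact: chart_at_dom.
by rewrite frame_chart_at mul1mx trmx1 mulmx1.
Qed.

Lemma covrep_chart_at (w : covfield M) p :
  covrep (chart_at p) w (coord (chart_at p) p) = w p.
Proof.
rewrite /covrep coordK; last exact: chart_at_dom.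
by rewrite frame_chart_at mul1mx.
Qed.

Lemma vrep_trans i j X y : overlap i j y ->
  vrep j X (coord j (param i y)) = vrep i X y *m trans i j y.
Proof.
move=> /overlap_param[iy jy yE]; rewrite /vrep (coordK jy).
by rewrite (coframe_trans iy jy) yE mulmxA.
Qed.

Lemma vrep_endo_app i (A : endofield M) X y : chart_image i y ->
  vrep i (endo_app A X) y = vrep i X y *m endorep i A y.
Proof.
move=> /chart_imageP[iy _]; rewrite /vrep /endorep /endo_app.
move: (coframeK iy); move: (coframe _ _) (frame _ _) => C F CF.
by rewrite !mulmxA -(mulmxA _ C) CF mulmx1.
Qed.

Lemma cov_app_param i (w : covfield M) X y : chart_image i y ->
  cov_app w X (param i y) = (vrep i X y *m covrep i w y) 0 0.
Proof.
move=> /chart_imageP[iy _]; rewrite /vrep /covrep /cov_app.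
move: (coframeK iy); move: (coframe _ _) (frame _ _) => C F CF.
by rewrite !mulmxA -(mulmxA _ C) CF mulmx1.
Qed.

Lemma bil_app_param i (g : bilfield M) X Y y : chart_image i y ->
  bil_app g X Y (param i y)
  = (vrep i X y *m bilrep i g y *m (vrep i Y y)^T) 0 0.
Proof.
move=> /chart_imageP[iy _]; rewrite /vrep /bilrep /bil_app trmx_mul.
move: (coframeK iy); move: (coframe _ _) (frame _ _) => C F CF.
have CFT : F^T *m C^T = 1%:M by rewrite -trmx_mul CF trmx1.
by rewrite !mulmxA -(mulmxA _ C) CF mulmx1 -(mulmxA _ F^T) CFT mulmx1.
Qed.

Lemma endorepM i (A B : endofield M) y : chart_image i y ->
  endorep i (fun p => A p *m B p) y = endorep i A y *m endorep i B y.
Proof.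
move=> /chart_imageP[iy _]; rewrite /endorep.
move: (coframeK iy); move: (coframe _ _) (frame _ _) => C F CF.
by rewrite !mulmxA -(mulmxA _ C) CF mulmx1.
Qed.

Lemma bilrepM i (A : endofield M) (g : bilfield M) y : chart_image i y ->
  bilrep i (fun p => A p *m g p) y = endorep i A y *m bilrep i g y.
Proof.
move=> /chart_imageP[iy _]; rewrite /endorep /bilrep.
move: (coframeK iy); move: (coframe _ _) (frame _ _) => C F CF.
by rewrite !mulmxA -(mulmxA _ C) CF mulmx1.
Qed.

(** Test fields for the contact and Killing conditions: constant components in chart i, and an
    arbitrary value at a given point of [cdom i]. *)
Definition coord_field i (v : 'rV[R]_m) : vfield M := fun p => v *m frame i p.

Lemma vrep_coord_field i v y : chart_image i y ->
  vrep i (coord_field i v) y = v.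
Proof.
move=> /chart_imageP[iy _].
by rewrite /vrep /coord_field -mulmxA frameK ?mulmx1.
Qed.

Lemma coord_field_chart_at p v : coord_field (chart_at p) v p = v.
Proof. by rewrite /coord_field frame_chart_at mulmx1. Qed.

Lemma coord_field_smooth i v : smooth_vfield_on (cdom i) (coord_field i v).
Proof.
move=> j k; have oji := open_overlap j i.
have C : Ck_on k (overlap j i)
    (fun z => v *m trans i j (coord i (param j z))).
  apply: Ck_on_mulmx => //; first exact: Ck_on_cst.
  apply: (Ck_on_compmx (U' := overlap i j) (H := trans i j)) => //.
  - exact: open_overlap.
  - by move=> x /overlap_param[jx ix _]; exact: mem_overlap.
  - exact: transition_Ck.
  - exact: trans_Ck.
apply: eq_Ck_on C => // z /overlap_param[jz iz _].
by rewrite /vrep /coord_field -mulmxA frame_coframe.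
Qed.

Lemma vderive_chart i X (h : M -> R) p : cdom i p ->
  differentiable (h \o param i : 'rV[R]_m -> R^o) (coord i p) ->
  vderive X h p
  = 'D_(vrep i X (coord i p)) (h \o param i : 'rV[R]_m -> R^o) (coord i p).
Proof.
move=> ip dh; rewrite /vderive; set c := chart_at p.
have cp : cdom c p by exact: chart_at_dom.
have yE : coord i p = (coord i \o param c) (coord c p) by rewrite /= coordK.
have ci := mem_overlap cp ip.
rewrite (vrep_coord _ ip) coframeE -/c -(derive_transition _ ci).
have dh' : differentiable (h \o param i : 'rV[R]_m -> R^o)
    ((coord i \o param c) (coord c p)) by rewrite -yE.
rewrite yE -(derive_comp_rV _ (transition_diff ci) dh').
apply: near_eq_derive; near=> x.
have cix : overlap c i x by near: x; exact: near_overlap.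
by have [_ ix _] := overlap_param cix; rewrite /= (coordK ix).
Unshelve. all: by end_near. Qed.

Lemma derive_trans_sym i j y u v : overlap i j y ->
  v *m 'D_u (trans i j) y = u *m 'D_v (trans i j) y.
Proof.
move=> ijy; have -> : trans i j = jacobian (coord j \o param i).
  by apply/funext => x; rewrite transE.
exact: derive_jacobian_sym (open_overlap i j) ijy (transition_Ck i j 2).
Qed.

Lemma derive_vrep_chart i j u X p : cdom i p -> cdom j p ->
  differentiable (vrep i X) (coord i p) ->
  'D_u (vrep j X) (coord j p) =
    'D_(u *m trans j i (coord j p)) (vrep i X) (coord i p)
      *m trans i j (coord i p)
    + vrep i X (coord i p)
      *m 'D_(u *m trans j i (coord j p)) (trans i j) (coord i p).
Proof.
move=> ip jp dX; set v := _ *m trans j i _.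
have yE : coord i p = (coord i \o param j) (coord j p) by rewrite /= coordK.
pose F y := vrep i X y *m trans i j y.
have [dt _] := trans_Ck i j 1.
have dt' := diff_is_derive v (dt _ (mem_overlap ip jp)).
have dX' := diff_is_derive v dX.
have dF := is_derive_mulmx dX' dt'.
transitivity ('D_u (F \o (coord i \o param j)) (coord j p)).
  apply: near_eq_derive; near=> x.
  have jix : overlap j i x by near: x; exact: near_overlap.
  have [jx ix xE] := overlap_param jix.
  have := vrep_trans X (mem_overlap ix jx).
  by rewrite (coordK ix) xE /F /=.
have dFy : differentiable F (coord i p).
  have [dt1 _] := trans_Ck i j 1; have dti := dt1 _ (mem_overlap ip jp).
  apply/differentiable_mxP => a b.
  have -> : (fun y => F y a b) =
      \sum_k ((fun y => vrep i X y a k) * (fun y => trans i j y k b)).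
    by apply/funext => y; rewrite fct_sumE mxE.
  apply: differentiable_sum => k; apply: differentiableM.
    exact: (differentiable_mxP _ _).1.
  exact: (differentiable_mxP _ _).1.
have ji := mem_overlap jp ip.
have dF' : differentiable F ((coord i \o param j) (coord j p)).
  by rewrite -yE.
rewrite (derive_comp_rV _ (transition_diff ji) dF') (derive_transition _ ji).
by rewrite -yE -/v; have [_ ->] := dF.
Unshelve. all: by end_near. Qed.

(** Changing charts adds a second derivative of the transition map to each half of the bracket; the
    two cancel by symmetry. *)
Lemma lie_bracket_chart i X Y p : cdom i p ->
  differentiable (vrep i X) (coord i p) ->
  differentiable (vrep i Y) (coord i p) ->
  lie_bracket X Y p *m coframe i p =
    'D_(vrep i X (coord i p)) (vrep i Y) (coord i p)
    - 'D_(vrep i Y (coord i p)) (vrep i X) (coord i p).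
Proof.
move=> ip dX dY; have cp := chart_at_dom p.
have eX := derive_vrep_chart (Y p) ip cp dX.
have eY := derive_vrep_chart (X p) ip cp dY.
have ci := mem_overlap ip cp.
set c := chart_at p in cp eX eY ci *.
have bE := f_equal2 (fun a b : 'rV[R]_m => a - b) eY eX.
have sym := derive_trans_sym (X p *m coframe i p) (Y p *m coframe i p) ci.
rewrite {}[lie_bracket X Y p]bE -coframeE (vrep_coord X ip) (vrep_coord Y ip).
rewrite sym opprD addrACA subrr addr0.
by rewrite -mulmxBl -mulmxA -frameE (frameK ip) mulmx1.
Qed.

End Charts.

Section MatrixAux.
Variables (R : realType).

Lemma bilin_ext m n (A B : 'M[R]_(m, n)) :
  (forall (u : 'rV[R]_m) (v : 'rV[R]_n),
     (u *m A *m v^T) 0 0 = (u *m B *m v^T) 0 0) -> A = B.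
Proof.
move=> H; apply/matrixP => i j.
have := H (delta_mx 0 i) (delta_mx 0 j).
by rewrite -!rowE trmx_delta -!colE !mxE.
Qed.

Lemma tr00 (A : 'M[R]_1) : A^T 0 0 = A 0 0.
Proof. by rewrite mxE. Qed.

(** Tensoriality of d: the terms that differentiate the fields ([da], [db]) cancel against the
    bracket, and only the antisymmetrized derivative W of the form remains. *)
Lemma ext_deriv_algebra m (da db a b : 'rV[R]_m) (c : 'cV[R]_m) (W : 'M[R]_m) :
  (da *m c) 0 0 + (b *m (a *m W)^T) 0 0
  - ((db *m c) 0 0 + (a *m (b *m W)^T) 0 0) - ((da - db) *m c) 0 0
  = (a *m (W - W^T) *m b^T) 0 0.
Proof.
have -> : (b *m (a *m W)^T) 0 0 = (a *m W *m b^T) 0 0.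
  by rewrite -[LHS]tr00 trmx_mul trmxK.
have -> : a *m (b *m W)^T = a *m W^T *m b^T by rewrite trmx_mul mulmxA.
rewrite mulmxBl mulmxBr mulmxBl.
move: (da *m c) (db *m c) (a *m W *m b^T) (a *m W^T *m b^T) => r1 r2 r3 r4.
by rewrite !mxE; ring.
Qed.

Lemma smooth_diff (V W : normedModType R) (U : set V) (F : V -> W) x :
  smooth_on U F -> U x -> differentiable F x.
Proof. by move=> sF Ux; have [d _] := sF 1%N; exact: d. Qed.

End MatrixAux.

Section ExteriorDerivative.
Variables (R : realType) (m : nat) (M : smooth_manifold R m).
Implicit Types (i j l : chart_idx M) (k : nat) (p q : M) (x y : 'rV[R]_m).

Lemma near_chart_image i p : cdom i p ->
  \forall y \near coord i p, chart_image i y.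
Proof.
move=> ip; apply: open_nbhs_nbhs; split; first exact: open_chart_image.
by exists p.
Qed.

(** Needed in an arbitrary chart i: near p the definition refers to charts [chart_at q] that vary
    with q, which cannot be differentiated. *)
Lemma ext_deriv_chart i (w : covfield M) X Y p : cdom i p ->
  differentiable (vrep i X) (coord i p) ->
  differentiable (vrep i Y) (coord i p) ->
  differentiable (covrep i w) (coord i p) ->
  ext_deriv w X Y p = 2^-1 *
    (vrep i X (coord i p)
     *m (jacobian (fun y => (covrep i w y)^T) (coord i p)
         - (jacobian (fun y => (covrep i w y)^T) (coord i p))^T)
     *m (vrep i Y (coord i p))^T) 0 0.
Proof.
move=> ip dX dY dw; set y := coord i p in dX dY dw *.
set W := jacobian _ y.
set a := vrep i X y; set b := vrep i Y y.
have dwT : differentiable (fun y => (covrep i w y)^T) y.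
  apply/differentiable_mxP => r c.
  have := (differentiable_mxP _ _).1 dw c r.
  by apply: near_eq_differentiable; near=> z; rewrite [RHS]mxE.
have dcov Z v : differentiable (vrep i Z) y ->
    is_derive y v (cov_app w Z \o param i : 'rV[R]_m -> R^o)
      (('D_v (vrep i Z) y *m covrep i w y) 0 0
       + (vrep i Z y *m (v *m W)^T) 0 0) /\
    differentiable (cov_app w Z \o param i : 'rV[R]_m -> R^o) y.
  move=> dZ.
  have E : \forall z \near y, (vrep i Z z *m covrep i w z) 0 0
      = (cov_app w Z \o param i) z.
    near=> z; rewrite /= (@cov_app_param _ _ _ i) //.
    by near: z; exact: near_chart_image.
  split.
    apply: near_eq_is_derive E _.
    have dwv : is_derive y v (covrep i w) (v *m W)^T.
      have -> : covrep i w = fun z => ((covrep i w z)^T)^T.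
        by apply/funext => z; rewrite trmxK.
      rewrite /W -deriveEjacobian //.
      exact: is_derive_trmx (diff_is_derive v dwT).
    have := is_derive_mulmx (diff_is_derive v dZ) dwv.
    by move=> /is_derive_mx /(_ 0 0); rewrite mxE.
  apply: near_eq_differentiable E _.
  have -> : (fun z => (vrep i Z z *m covrep i w z) 0 0) =
      \sum_k ((fun z => vrep i Z z 0 k) * (fun z => covrep i w z k 0)).
    by apply/funext => z; rewrite fct_sumE mxE.
  apply: differentiable_sum => k; apply: differentiableM.
    exact: (differentiable_mxP _ _).1.
  exact: (differentiable_mxP _ _).1.
have [dcX ddX] := dcov X b dX; have [dcY ddY] := dcov Y a dY.
have eY := vderive_chart X ip ddY; have eX := vderive_chart Y ip ddX.
rewrite /ext_deriv [vderive X _ _]eY [vderive Y _ _]eX.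
have [_ ->] := dcX; have [_ ->] := dcY.
have -> : cov_app w (lie_bracket X Y) p
    = (('D_a (vrep i Y) y - 'D_b (vrep i X) y) *m covrep i w y) 0 0.
  rewrite -(lie_bracket_chart ip dX dY) -[p in LHS](coordK ip).
  rewrite (@cov_app_param _ _ _ i); last by exists p.
  by rewrite vrep_coord // coordK.
congr (_ * _); exact: ext_deriv_algebra.
Unshelve. all: by end_near. Qed.

End ExteriorDerivative.

(** * Weak f-contact and weak f-K-contact structures *)

Section Pointwise.
Variables (R : realType) (m : nat) (M : smooth_manifold R m).
Implicit Types (c : chart_idx M) (p : M) (x y u v : 'rV[R]_m).

Lemma coord_field_diff c u p : cdom c p ->
  differentiable (vrep c (coord_field c u)) (coord c p).
Proof.
move=> cp; apply: (@near_eq_differentiable _ _ _ (cst u)); last first.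
  exact: differentiable_cst.
near=> y; rewrite vrep_coord_field //.
by near: y; exact: near_chart_image.
Unshelve. all: by end_near. Qed.

Lemma chart_image_coord c p : cdom c p -> chart_image c (coord c p).
Proof. by move=> cp; exists p. Qed.

Lemma covector_sum_form s (w : 'I_s -> 'cV[R]_m) u v :
  (u *m (\sum_i w i *m (w i)^T) *m v^T) 0 0
  = \sum_i (u *m w i) 0 0 * (v *m w i) 0 0.
Proof.
rewrite mulmx_sumr mulmx_suml summxE; apply: eq_bigr => i _.
rewrite !mulmxA -(mulmxA _ (w i)^T) -trmx_mul [LHS]mxE.
by rewrite big_ord1 tr00.
Qed.

Section Structure.
Variables (s : nat) (xi : 'I_s -> vfield M) (eta : 'I_s -> covfield M).
Variables (f Q : endofield M) (g : bilfield M).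
Hypothesis hc : weak_f_contact xi eta f Q g.

Let hw : weak_metric_f_structure xi eta f Q g := hc.1.

(** The transpose makes the covector a row, as [jacobian] expects; entry (a, b) is the a-th partial
    derivative of the b-th component. *)
Definition eta_jac i c y := jacobian (fun z => (covrep c (eta i) z)^T) y.

Lemma covrep_diff i c p : cdom c p ->
  differentiable (covrep c (eta i)) (coord c p).
Proof.
move=> cp; apply: smooth_diff (wf_smooth_eta hw i c) _.
exact: chart_image_coord.
Qed.

(** The identity Phi = d eta^i tested on coordinate fields. It holds on the whole chart image, so
    [lie_Phi] may differentiate it. *)
Lemma contact_rep i c y : chart_image c y ->
  bilrep c g y *m (endorep c f y)^T
  = 2^-1 *: (eta_jac i c y - (eta_jac i c y)^T).
Proof.
move=> [p cp <-]; apply: bilin_ext => u v.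
have cy := chart_image_coord cp.
have H := hc.2 i _ _ _ (cdom_open c) (@coord_field_smooth _ _ _ c u)
  (@coord_field_smooth _ _ _ c v) p cp.
rewrite (ext_deriv_chart cp (coord_field_diff u cp) (coord_field_diff v cp)
  (covrep_diff i cp)) in H.
have K := bil_app_param g (coord_field c u) (endo_app f (coord_field c v)) cy.
rewrite (coordK cp) in K; rewrite K in H.
rewrite vrep_endo_app // !vrep_coord_field // in H.
rewrite /eta_jac -scalemxAr -scalemxAl [RHS]mxE -H.
by move: (bilrep _ _ _) (endorep _ _ _) => a b; rewrite trmx_mul !mulmxA.
Qed.

Hypothesis hs : (0 < s)%N.

Lemma g_sym p : (g p)^T = g p.
Proof. by have [_ gs _] := wf_riemannian hw. Qed.

Lemma g_posdef p : posdef (g p).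
Proof. by have [_ gs gp] := wf_riemannian hw; split; [exact: gs|exact: gp]. Qed.

Lemma f_skew p : g p *m (f p)^T = - (f p *m g p).
Proof.
have cp := chart_at_dom p.
have H := contact_rep (Ordinal hs) (chart_image_coord cp).
rewrite bilrep_chart_at endorep_chart_at in H.
have E : f p *m g p = (g p *m (f p)^T)^T.
  by rewrite trmx_mul trmxK g_sym.
rewrite E H; move: (eta_jac _ _ _) => W.
by apply/matrixP => a b; rewrite !mxE; ring.
Qed.

Lemma f_metric p :
  f p *m g p *m (f p)^T = g p *m (Q p)^T - \sum_i eta i p *m (eta i p)^T.
Proof.
apply: bilin_ext => u v.
have := wf_metric hw (fun=> u) (fun=> v) p.
rewrite /bil_app /endo_app /cov_app !trmx_mul !mulmxA => ->.
rewrite mulmxBr mulmxBl [RHS]mxE !mulmxA; congr (_ + _).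
by rewrite [RHS]mxE covector_sum_form.
Qed.

Lemma eta_xi i j p : xi j p *m eta i p = (i == j)%:R%:M.
Proof.
apply/matrixP => a b; rewrite !ord1 [RHS]mxE mulr1n.
exact: wf_eta_xi hw i j p.
Qed.

Lemma xi_Q i p : xi i p *m Q p = xi i p.
Proof. exact: wf_Q_xi hw i p. Qed.

Lemma sum_xi_eta j p :
  \sum_i (xi j p *m (eta i p *m xi i p)) = xi j p.
Proof.
rewrite (bigD1 j) //= mulmxA eta_xi eqxx mul1mx big1 ?addr0 // => i ij.
by rewrite mulmxA eta_xi (negbTE ij) mul_scalar_mx scale0r.
Qed.

(** By skewness |f xi|^2 = - g(f^2 xi, xi), and f^2 xi = - Q xi + xi = 0. *)
Lemma xi_f j p : xi j p *m f p = 0.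
Proof.
apply: (posdef_eq0 (g_posdef p)).
have ff : xi j p *m (f p *m f p) = 0.
  by rewrite (wf_f_square hw) mulmxDr mulmxN xi_Q mulmx_sumr sum_xi_eta addNr.
rewrite trmx_mul mulmxA -(mulmxA (xi j p *m f p)) f_skew mulmxN.
rewrite -!mulmxA (mulmxA (f p)) (mulmxA (xi j p)) ff.
by rewrite !mul0mx mulNmx mul0mx oppr0 mxE.
Qed.

(** Put xi_j into one slot of the metric compatibility: f xi_j = 0 and Q xi_j = xi_j leave exactly
    this. *)
Lemma eta_metric j p : eta j p = g p *m (xi j p)^T.
Proof.
have := congr1 (fun A => A *m (xi j p)^T) (f_metric p).
rewrite -mulmxA -trmx_mul xi_f linear0 mulmx0 => /esym/eqP.
rewrite mulmxBl subr_eq0 -mulmxA -trmx_mul xi_Q => /eqP ->.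
rewrite mulmx_suml (bigD1 j) //= -mulmxA -trmx_mul eta_xi eqxx trmx1 mulmx1.
rewrite big1 ?addr0 // => i ij.
rewrite -mulmxA -trmx_mul eta_xi (negbTE ij) -scalemx1 scale0r.
by rewrite linear0 mulmx0.
Qed.

Lemma f_eta j p : f p *m eta j p = 0.
Proof.
rewrite eta_metric mulmxA -[X in X *m _]opprK -f_skew mulNmx -mulmxA.
by rewrite -trmx_mul xi_f linear0 mulmx0 oppr0.
Qed.

Lemma Q_selfadjoint p : (Q p *m g p)^T = Q p *m g p.
Proof.
have E : g p *m (Q p)^T
    = f p *m g p *m (f p)^T + \sum_i eta i p *m (eta i p)^T.
  by rewrite f_metric subrK.
have E1 : (f p *m g p *m (f p)^T)^T = f p *m g p *m (f p)^T.
  by rewrite !trmx_mul trmxK g_sym mulmxA.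
have E2 : (\sum_i eta i p *m (eta i p)^T)^T = \sum_i eta i p *m (eta i p)^T.
  apply/matrixP => a b; rewrite mxE !summxE; apply: eq_bigr => i _.
  by rewrite !mxE; apply: eq_bigr => k _; rewrite !mxE mulrC.
have -> : Q p *m g p = (g p *m (Q p)^T)^T.
  by rewrite trmx_mul trmxK g_sym.
by rewrite trmxK E linearD /= E1 E2.
Qed.

(** The value is |f u|^2 + sum_i eta^i(u)^2. If it vanishes, the formula for f^2 gives Q u = 0, and
    Q is nonsingular. *)
Lemma Q_posdef p u : u != 0 -> 0 < (u *m Q p *m g p *m u^T) 0 0.
Proof.
move=> u0; rewrite -(mulmxA u) -Q_selfadjoint trmx_mul g_sym.
have E : g p *m (Q p)^T
    = f p *m g p *m (f p)^T + \sum_i eta i p *m (eta i p)^T.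
  by rewrite f_metric subrK.
rewrite E mulmxDr mulmxDl mxE covector_sum_form.
have fE : (u *m (f p *m g p *m (f p)^T) *m u^T) 0 0
    = ((u *m f p) *m g p *m (u *m f p)^T) 0 0 by rewrite trmx_mul !mulmxA.
have A0 := posdef_ge0 (u *m f p) (g_posdef p).
have B0 : 0 <= \sum_i (u *m eta i p) 0 0 * (u *m eta i p) 0 0.
  by apply: sumr_ge0 => i _; rewrite -expr2 sqr_ge0.
rewrite fE lt_def addr_ge0 // andbT paddr_eq0 //.
apply: contra_neqN u0 => /andP[/eqP uf ue].
have {}uf : u *m f p = 0.
  by apply: (posdef_eq0 (g_posdef p)); rewrite uf.
have {}ue i : u *m eta i p = 0.
  apply/matrixP => a b; rewrite !ord1 [RHS]mxE.
  apply/eqP; rewrite -sqrf_eq0 expr2; apply/eqP.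
  by apply: (psumr_eq0P _ (eqP ue)) => // k _; rewrite -expr2 sqr_ge0.
have uQ : u *m Q p = 0.
  have := congr1 (mulmx u) (wf_f_square hw p).
  rewrite mulmxA uf mul0mx mulmxDr mulmxN mulmx_sumr big1 ?addr0 => [|i _].
    by move=> /esym/eqP; rewrite oppr_eq0 => /eqP.
  by rewrite mulmxA ue mul0mx.
by rewrite -[u](mulmxK (wf_Q_nonsingular hw p)) uQ mul0mx.
Qed.

(** f commutes with its own square, and the terms eta^i xi_i of that square are killed by f on
    either side. *)
Lemma f_Q p : f p *m Q p = Q p *m f p.
Proof.
have : f p *m (f p *m f p) = f p *m f p *m f p by rewrite mulmxA.
rewrite (wf_f_square hw) mulmxDr mulmxDl mulmx_sumr mulmx_suml.
rewrite !big1 => [| i _ | i _].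
- by rewrite !addr0 mulmxN mulNmx => /oppr_inj.
- by rewrite -mulmxA xi_f mulmx0.
- by rewrite mulmxA f_eta mul0mx.
Qed.

End Structure.
End Pointwise.

(** * Matrix identities behind Lie derivatives in coordinates *)

Section JacobianLie.
Variables (R : realType) (m : nat).
Implicit Types (u v X : 'rV[R]_m) (w : 'cV[R]_m) (J W : 'M[R]_m).

Lemma trmxD p q (A B : 'M[R]_(p, q)) : (A + B)^T = A^T + B^T.
Proof. exact: linearD. Qed.

(** The second hypothesis is the u-derivative of X W = - (J w)^T, the coordinate form of L_xi eta =
    0. The first moves the second derivative of eta onto the direction X. *)
Lemma jacobian_lie_row u X w J W DuW DXW DuJ :
  X *m DuW = u *m DXW ->
  u *m J *m W + X *m DuW = - (DuJ *m w + J *m (u *m W)^T)^T ->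
  u *m (J *m W + DXW + W *m J^T) = - (DuJ *m w)^T.
Proof.
move=> ->; rewrite [(_ + _)^T]linearD /= [(J *m _)^T]trmx_mul trmxK.
by rewrite !mulmxDr !mulmxA => ->; rewrite opprD subrK.
Qed.

(* [W] is the matrix of first derivatives of eta, [DW] its derivative along xi,
   and [A u] the derivative along [u] of the Jacobian [J] of xi. *)
Lemma jacobian_lie_antisym w J W DW (A : 'rV[R]_m -> 'M[R]_m) :
  (forall u, u *m (J *m W + DW + W *m J^T) = - (A u *m w)^T) ->
  (forall u v, v *m A u = u *m A v) ->
  2^-1 *: (DW - DW^T) = - (J *m (2^-1 *: (W - W^T))
    + 2^-1 *: (W - W^T) *m J^T).
Proof.
move=> F sA.
pose N := J *m W + DW + W *m J^T.
have F' u v : (u *m N *m v^T) 0 0 = - (v *m A u *m w) 0 0.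
  rewrite F mulNmx -trmx_mul mulmxA [LHS]mxE; congr (- _); exact: tr00.
have Ns : N = N^T.
  apply: bilin_ext => u v; rewrite F' -sA -F' -[RHS]tr00.
  by rewrite !trmx_mul !trmxK mulmxA.
apply/matrixP => a b; have := congr1 (fun B : 'M[R]_m => B a b) Ns.
have -> : N^T = W^T *m J^T + DW^T + J *m W^T.
  by rewrite /N !trmxD !trmx_mul trmxK.
rewrite /N -scalemxAr -scalemxAl mulmxBr mulmxBl.
move: (J *m W) (J *m W^T) (W *m J^T) (W^T *m J^T) => r1 r2 r3 r4.
by rewrite !mxE; lra.
Qed.

(** With rows as vectors and J the Jacobian of xi, L_xi of a form B is D B + J B + B J^T, and L_xi
    of an endomorphism E is D E + J E - E J. So invariance of g and of g(., E .) forces that of E,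
    since g is invertible. *)
Lemma lie_endo_of_form (G E DG DE J : 'M[R]_m) : G \in unitmx ->
  DG = - (J *m G + G *m J^T) ->
  DG *m E^T + G *m DE^T = - (J *m (G *m E^T) + G *m E^T *m J^T) ->
  DE = E *m J - J *m E.
Proof.
move=> Gu -> H; apply: trmx_inj.
have -> : (E *m J - J *m E)^T = J^T *m E^T - E^T *m J^T.
  by rewrite linearB /= !trmx_mul.
rewrite -[LHS](mulKmx Gu) -[RHS](mulKmx Gu); congr (_ *m _).
rewrite -[LHS](addKr (- (J *m G + G *m J^T) *m E^T)) H.
rewrite mulmxBr mulNmx mulmxDl !mulmxA.
move: (J *m G *m E^T) (G *m J^T *m E^T) (G *m E^T *m J^T) => r1 r2 r3.
by apply/matrixP => a b; rewrite !mxE; ring.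
Qed.

(** Leibniz rule: invariance of g and f gives that of the form g(f ., f .). *)
Lemma lie_form_congruence (G F DG DF J : 'M[R]_m) :
  DG = - (J *m G + G *m J^T) -> DF = F *m J - J *m F ->
  (DF *m G + F *m DG) *m F^T + F *m G *m DF^T
  = - (J *m (F *m G *m F^T) + F *m G *m F^T *m J^T).
Proof.
move=> -> ->.
have -> : (F *m J - J *m F)^T = J^T *m F^T - F^T *m J^T.
  by rewrite linearB /= !trmx_mul.
rewrite !(mulmxBl, mulmxDl, mulmxBr, mulmxDr, mulNmx, mulmxN) !mulmxA.
move: (F *m J *m G *m F^T) (J *m F *m G *m F^T) (F *m G *m J^T *m F^T)
  (F *m G *m F^T *m J^T) => r1 r2 r3 r4.
by apply/matrixP => a b; rewrite !mxE; ring.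
Qed.

End JacobianLie.

Lemma near_vrep_coord_field (R : realType) m (M : smooth_manifold R m)
    (c : chart_idx M) (u : 'rV[R]_m) (p : M) : cdom c p ->
  \forall y \near coord c p, vrep c (coord_field c u) y = u.
Proof.
by move=> /near_chart_image; apply: filterS => y; exact: vrep_coord_field.
Qed.

Section Lie.
Variables (R : realType) (m : nat) (M : smooth_manifold R m).
Implicit Types (c : chart_idx M) (p : M) (x y u v : 'rV[R]_m).
Variables (s : nat) (xi : 'I_s -> vfield M) (eta : 'I_s -> covfield M).
Variables (f Q : endofield M) (g : bilfield M).

Definition xi_jac j c y := jacobian (vrep c (xi j)) y.

Section Contact.
Hypothesis hc : weak_f_contact xi eta f Q g.
Let hw : weak_metric_f_structure xi eta f Q g := hc.1.
Hypothesis hs : (0 < s)%N.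

Lemma xi_Ck k j c : Ck_on k (chart_image c) (vrep c (xi j)).
Proof. by have := wf_smooth_xi hw j c k; rewrite setIT. Qed.

Lemma eta_Ck k i c : Ck_on k (chart_image c) (covrep c (eta i)).
Proof. exact: wf_smooth_eta hw i c k. Qed.

Lemma etaT_Ck k i c : Ck_on k (chart_image c) (fun y => (covrep c (eta i) y)^T).
Proof. by apply: Ck_on_trmx (eta_Ck k i c); exact: open_chart_image. Qed.

Lemma is_derive_xi j c y u : chart_image c y ->
  is_derive y u (vrep c (xi j)) (u *m xi_jac j c y).
Proof.
move=> cy; have [d _] := xi_Ck 1 j c.
by rewrite -deriveEjacobian; [exact/diff_is_derive/d|exact: d].
Qed.

Lemma is_derive_eta i c y u : chart_image c y ->
  is_derive y u (covrep c (eta i)) (u *m eta_jac eta i c y)^T.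
Proof.
move=> cy; have [d _] := etaT_Ck 1 i c.
have -> : covrep c (eta i) = fun z => ((covrep c (eta i) z)^T)^T.
  by apply/funext => z; rewrite trmxK.
rewrite -deriveEjacobian; last exact: d.
exact/is_derive_trmx/diff_is_derive/d.
Qed.

Lemma xi_endorep j c y : chart_image c y ->
  vrep c (xi j) y *m endorep c f y = 0.
Proof.
move=> cy; rewrite -vrep_endo_app //.
by rewrite /vrep /endo_app (xi_f hc hs) mul0mx.
Qed.

Lemma eta_xi_rep i j c y : chart_image c y ->
  vrep c (xi j) y *m covrep c (eta i) y = (i == j)%:R%:M.
Proof.
move=> cy; apply/matrixP => a b; rewrite !ord1 -cov_app_param //.
by rewrite (wf_eta_xi hw) mxE mulr1n.
Qed.

Lemma bilrep_sym c y : (bilrep c g y)^T = bilrep c g y.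
Proof. by rewrite /bilrep !trmx_mul trmxK (g_sym hc) mulmxA. Qed.

Lemma lie_eta i j c y : chart_image c y ->
  vrep c (xi j) y *m eta_jac eta i c y
  = - (xi_jac j c y *m covrep c (eta i) y)^T.
Proof.
move=> cy.
have H := contact_rep hc i cy.
have K : (bilrep c g y *m (endorep c f y)^T)^T
    = endorep c f y *m bilrep c g y by rewrite trmx_mul trmxK bilrep_sym.
have Z := xi_endorep j cy.
have E u : u *m (xi_jac j c y *m covrep c (eta i) y)
    + vrep c (xi j) y *m (u *m eta_jac eta i c y)^T = 0.
  have D := is_derive_mulmx (is_derive_xi j u cy) (is_derive_eta i u cy).
  have [_ DE] := D; rewrite mulmxA -DE.
  apply: (@derive_cst_near _ _ _ _ _ _ (i == j)%:R%:M); near=> z.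
  apply: eta_xi_rep; near: z; apply: open_nbhs_nbhs; split => //.
  exact: open_chart_image.
move: H K Z E; move: (bilrep _ _ _) (endorep _ _ _) (vrep _ _ _) => G F X.
move: (eta_jac _ _ _ _) (xi_jac _ _ _) (covrep _ _ _) => W J w H K Z E.
have XW : X *m W = X *m W^T.
  have : X *m (- 2%:R *: (F *m G)) = 0.
    by rewrite -scalemxAr mulmxA Z mul0mx scaler0.
  have -> : - 2%:R *: (F *m G) = W - W^T.
    by rewrite -K H; apply/matrixP => a b; rewrite !mxE; field.
  by rewrite mulmxBr => /eqP; rewrite subr_eq0 => /eqP.
rewrite XW; apply: trmx_inj; rewrite trmx_mul trmxK linearN /= trmxK.
apply/row_matrixP => a; rewrite !rowE mulmxN.
have -> : delta_mx 0 a *m (W *m X^T) = X *m (delta_mx 0 a *m W)^T.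
  by rewrite -[RHS]trmx11 !trmx_mul !trmxK mulmxA.
by apply/eqP; rewrite -addr_eq0 addrC E.
Unshelve. all: by end_near. Qed.

(* L_xi (d eta) = d (L_xi eta) = 0, in coordinates. *)
Lemma lie_Phi j c y : chart_image c y ->
  'D_(vrep c (xi j) y) (fun z => bilrep c g z *m (endorep c f z)^T) y
  = - (xi_jac j c y *m (bilrep c g y *m (endorep c f y)^T)
       + bilrep c g y *m (endorep c f y)^T *m (xi_jac j c y)^T).
Proof.
move=> cy; pose i := Ordinal hs.
have oU := @open_chart_image _ _ _ c.
have [dW _] := jacobian_Ck oU (etaT_Ck 2 i c).
have [dJ _] := jacobian_Ck oU (xi_Ck 2 j c).
have E u : u *m xi_jac j c y *m eta_jac eta i c y
      + vrep c (xi j) y *m 'D_u (eta_jac eta i c) y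
    = - ('D_u (xi_jac j c) y *m covrep c (eta i) y
         + xi_jac j c y *m (u *m eta_jac eta i c y)^T)^T.
  have [_ <-] := is_derive_mulmx (is_derive_xi j u cy)
    (diff_is_derive u (dW y cy)).
  have D := is_derive_mulmx (diff_is_derive u (dJ y cy)) (is_derive_eta i u cy).
  have [_ <-] := is_deriveN (is_derive_trmx D).
  apply: near_eq_derive; near=> z; apply: lie_eta.
  by near: z; exact: open_nbhs_nbhs.
have sW u : vrep c (xi j) y *m 'D_u (eta_jac eta i c) y
    = u *m 'D_(vrep c (xi j) y) (eta_jac eta i c) y.
  exact: derive_jacobian_sym oU cy (etaT_Ck 2 i c).
have sJ u v : v *m 'D_u (xi_jac j c) y = u *m 'D_v (xi_jac j c) y.
  exact: derive_jacobian_sym oU cy (xi_Ck 2 j c).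
have F u := jacobian_lie_row (sW u) (E u).
have [_ DWE] : is_derive y (vrep c (xi j) y)
    (fun z => 2^-1 *: (eta_jac eta i c z - (eta_jac eta i c z)^T))
    (2^-1 *: ('D_(vrep c (xi j) y) (eta_jac eta i c) y
      - ('D_(vrep c (xi j) y) (eta_jac eta i c) y)^T)).
  apply: is_deriveZ; apply: is_deriveB; first exact/diff_is_derive/dW.
  exact/is_derive_trmx/diff_is_derive/dW.
transitivity ('D_(vrep c (xi j) y)
    (fun z => 2^-1 *: (eta_jac eta i c z - (eta_jac eta i c z)^T)) y).
  apply: near_eq_derive; near=> z; apply: (contact_rep hc).
  by near: z; exact: open_nbhs_nbhs.
rewrite DWE (contact_rep hc i cy).
exact: jacobian_lie_antisym F sJ.
Unshelve. all: by end_near. Qed.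

End Contact.

(** L_{xi_j} A = 0, written at p in the chart chosen at p; the sign of the commutator is that of the
    row convention. *)
Definition endo_lie_invariant (A : endofield M) : Prop := forall j p,
  let c := chart_at p in let y := coord c p in
  'D_(xi j p) (endorep c A) y = A p *m xi_jac j c y - xi_jac j c y *m A p.

Section KContact.
Hypothesis hk : weak_f_K_contact xi eta f Q g.
Let hc : weak_f_contact xi eta f Q g := hk.1.
Let hw : weak_metric_f_structure xi eta f Q g := hc.1.
Hypothesis hs : (0 < s)%N.

Lemma metric_Ck k c : Ck_on k (chart_image c) (bilrep c g).
Proof. by have [sg _ _] := wf_riemannian hw; exact: sg. Qed.

(** The Killing condition on coordinate fields, whose bracket with xi reduces to minus the
    derivative of xi. *)
Lemma lie_metric j p (c := chart_at p) (y := coord c p) :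
  'D_(xi j p) (bilrep c g) y
  = - (xi_jac j c y *m g p + g p *m (xi_jac j c y)^T).
Proof.
have cp : cdom c p := chart_at_dom p.
have cy : chart_image c y by exists p.
have [dg _] := metric_Ck 1 c.
apply: bilin_ext => u v.
have H := hk.2 j _ _ _ (cdom_open c) (@coord_field_smooth _ _ _ c u)
  (@coord_field_smooth _ _ _ c v) p cp.
have br w : lie_bracket (xi j) (coord_field c w) p = - (w *m xi_jac j c y).
  have e1 : 'D_(xi j p) (vrep c (coord_field c w)) y = 0.
    exact: derive_cst_near (near_vrep_coord_field w cp).
  have e2 : 'D_(coord_field c w p) (vrep c (xi j)) y = w *m xi_jac j c y.
    by have [_ <-] := is_derive_xi hc j w cy; rewrite coord_field_chart_at.
  have := f_equal2 (fun a b : 'rV[R]_m => a - b) e1 e2.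
  by rewrite sub0r.
have vd : vderive (xi j) (bil_app g (coord_field c u) (coord_field c v)) p
    = (u *m 'D_(xi j p) (bilrep c g) y *m v^T) 0 0.
  transitivity ('D_(xi j p) (fun z => (u *m bilrep c g z *m v^T) 0 0) y).
    apply: near_eq_derive; near=> z.
    have cz : chart_image c z by near: z; exact: near_chart_image.
    by rewrite /= (bil_app_param g _ _ cz) !vrep_coord_field.
  have D := is_derive_mulmx (is_derive_mulmx (is_derive_cst u y (xi j p))
    (diff_is_derive (xi j p) (dg y cy))) (is_derive_cst v^T y (xi j p)).
  have [_ ->] := (is_derive_mx _ _ _ _).1 D 0 0.
  by rewrite mul0mx add0r mulmx0 addr0.
rewrite -vd H /bil_app !br !coord_field_chart_at.
move: (xi_jac _ _ _) (g p) => J G.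
rewrite linearN /= trmx_mul mulmxN !mulNmx mulmxN mulNmx mulmxDr mulmxDl.
rewrite !mulmxA.
by rewrite [RHS]mxE [(_ + _ : 'M[R]_1) _ _]mxE opprD ![(- _ : 'M[R]_1) _ _]mxE.
Unshelve. all: by end_near. Qed.

Lemma f_Ck k c : Ck_on k (chart_image c) (endorep c f).
Proof. exact: wf_smooth_f hw c k. Qed.

Lemma Q_Ck k c : Ck_on k (chart_image c) (endorep c Q).
Proof. exact: wf_smooth_Q hw c k. Qed.

Lemma is_derive_metric j p (c := chart_at p) (y := coord c p) :
  is_derive y (xi j p) (bilrep c g)
    (- (xi_jac j c y *m g p + g p *m (xi_jac j c y)^T)).
Proof.
rewrite -lie_metric; have [dg _] := metric_Ck 1 c.
by apply/diff_is_derive/dg; exists p => //; exact: chart_at_dom.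
Qed.

(** Both g and Phi = g(., f .) are invariant, by [lie_metric] and [lie_Phi]. *)
Lemma lie_f : endo_lie_invariant f.
Proof.
move=> j p c y; have cp : cdom c p := chart_at_dom p.
have cy : chart_image c y by exists p.
have [df _] := f_Ck 1 c.
have H := lie_Phi hc hs j cy.
rewrite (vrep_chart_at (xi j) p) in H.
have D := is_derive_mulmx (is_derive_metric j p)
  (is_derive_trmx (diff_is_derive (xi j p) (df y cy))).
have [_ DE] := D; rewrite DE in H.
rewrite (bilrep_chart_at g p) (endorep_chart_at f p) in H.
exact: lie_endo_of_form (posdef_unit (g_posdef hc p)) erefl H.
Qed.

Lemma f_metric_rep c y : chart_image c y ->
  endorep c f y *m bilrep c g y *m (endorep c f y)^T
    + \sum_i covrep c (eta i) y *m (covrep c (eta i) y)^T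
  = bilrep c g y *m (endorep c Q y)^T.
Proof.
move=> /chart_imageP[cy _]; have H := f_metric hc (param c y).
rewrite /endorep /bilrep /covrep; move: (coframeK cy) H.
move: (coframe _ _) (frame _ _) (f _) (Q _) (g _) => C B F q G CB H.
have BC : B^T *m C^T = 1%:M by rewrite -trmx_mul CB trmx1.
rewrite !trmx_mul !mulmxA -(mulmxA _ C) CB mulmx1 -(mulmxA _ B^T C^T) BC mulmx1.
rewrite -(mulmxA _ B^T C^T) BC mulmx1.
have -> : B *m G *m q^T *m B^T = B *m (G *m q^T) *m B^T by rewrite mulmxA.
have -> : B *m F *m G *m F^T *m B^T = B *m (F *m G *m F^T) *m B^T.
  by rewrite !mulmxA.
rewrite H mulmxBr mulmxBl mulmx_sumr mulmx_suml.
rewrite -[RHS]addr0 -addrA; congr (_ + _); apply/eqP.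
rewrite addrC subr_eq0; apply/eqP; apply: eq_bigr => i _.
by rewrite trmx_mul !mulmxA.
Qed.

Lemma near_f_metric_rep c p : cdom c p -> \forall z \near coord c p,
  ((fun y => endorep c f y *m bilrep c g y *m (endorep c f y)^T)
   + \sum_i (fun y => covrep c (eta i) y *m (covrep c (eta i) y)^T)) z
  = bilrep c g z *m (endorep c Q z)^T.
Proof.
move=> cp; near=> z; rewrite -f_metric_rep; last first.
  by near: z; exact: near_chart_image.
set B := \sum_i (fun y => covrep c (eta i) y *m _).
transitivity (endorep c f z *m bilrep c g z *m (endorep c f z)^T + B z) => //.
by congr (_ + _); rewrite /B fct_sumE.
Unshelve. all: by end_near. Qed.

(** The form g(., Q .) equals g(f ., f .) + sum_i eta^i eta^i, all of whose ingredients are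
    invariant; then g is cancelled as for f. *)
Lemma lie_Q : endo_lie_invariant Q.
Proof.
move=> j p c y; have cp : cdom c p := chart_at_dom p.
have cy : chart_image c y by exists p.
have [df _] := f_Ck 1 c; have [dQ _] := Q_Ck 1 c.
have dfE := diff_is_derive (xi j p) (df y cy).
have D1 := is_derive_mulmx (is_derive_mulmx dfE (is_derive_metric j p))
  (is_derive_trmx dfE).
have Dw i : is_derive y (xi j p)
    (fun z => covrep c (eta i) z *m (covrep c (eta i) z)^T)
    (- (xi_jac j c y *m (eta i p *m (eta i p)^T)
        + eta i p *m (eta i p)^T *m (xi_jac j c y)^T)).
  have dw := is_derive_eta hc i (xi j p) cy.
  have := is_derive_mulmx dw (is_derive_trmx dw).
  have := lie_eta hc hs i j cy; rewrite (vrep_chart_at (xi j) p) => ->.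
  rewrite (covrep_chart_at (eta i) p) linearN /= !trmxK linearN /= trmx_mul.
  by rewrite mulNmx mulmxN -opprD !mulmxA.
have D2 := is_deriveD D1 (is_derive_sum Dw).
have D3 := is_derive_mulmx (is_derive_metric j p)
  (is_derive_trmx (diff_is_derive (xi j p) (dQ y cy))).
have [_ E2] := D2; have [_ E3] := D3.
have E23 := @near_eq_derive _ _ _ _ _ y (xi j p) (near_f_metric_rep cp).
have H : _ = _ := etrans (etrans (esym E3) (esym E23)) E2.
have fE := lie_f j p.
rewrite -/c -/y in fE H; rewrite fE in H.
rewrite (bilrep_chart_at g p) (endorep_chart_at f p) in H.
rewrite (endorep_chart_at Q p) in H.
rewrite (lie_form_congruence erefl erefl) in H.
apply: lie_endo_of_form (posdef_unit (g_posdef hc p)) erefl _; rewrite H.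
have -> : g p *m (Q p)^T
    = f p *m g p *m (f p)^T + \sum_i eta i p *m (eta i p)^T.
  by rewrite (f_metric hc) subrK.
move: (f p *m g p *m (f p)^T) (xi_jac _ _ _) => K J.
rewrite mulmxDr mulmxDl addrACA [in RHS]opprD; congr (_ + _).
by rewrite mulmx_sumr mulmx_suml -big_split /= -sumrN.
Qed.

(* E = L_xi S solves S E + E S = L_xi Q = 0. *)
Lemma lie_sqrt (S : endofield M) : smooth_endofield S ->
  (forall p, S p *m S p = Q p) -> (forall p, posdef (S p *m g p)) ->
  endo_lie_invariant S.
Proof.
move=> sS SQ Sp j p c y; have cp : cdom c p := chart_at_dom p.
have cy : chart_image c y by exists p.
have [dS _] := sS c 1%N.
have dSE := diff_is_derive (xi j p) (dS y cy).
have [_ E1] := is_derive_mulmx dSE dSE.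
have nE : \forall z \near y, endorep c S z *m endorep c S z = endorep c Q z.
  near=> z; rewrite -endorepM; last by near: z; exact: near_chart_image.
  by congr (endorep c _ z); apply/funext => q; exact: SQ.
have E2 := @near_eq_derive _ _ _ _ _ y (xi j p) nE.
have H : _ = _ := etrans (esym E1) E2.
have QE := lie_Q j p; rewrite -/c -/y in QE; rewrite QE in H.
rewrite (endorep_chart_at S p) in H.
apply/eqP; rewrite -subr_eq0; apply/eqP.
apply: (sylvester_eq0 (g_posdef hc p) (Sp p)) => [u|].
  by rewrite -(mulmxA u); exact: (posdef_ge0 u (Sp p)).
move: H; rewrite -SQ; move: ('D_(_) _ _) (S p) (xi_jac _ _ _) => D T J H.
rewrite mulmxBr mulmxBl addrACA [T *m D + _]addrC H.
rewrite mulmxBr mulmxBl !mulmxA.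
move: (T *m T *m J) (J *m T *m T) (T *m J *m T) => r1 r2 r3.
by apply/matrixP => a b; rewrite !mxE; ring.
Unshelve. all: by end_near. Qed.

End KContact.
End Lie.

Section Projection.
Variables (R : realType) (m : nat) (M : smooth_manifold R m).
Variables (s : nat) (xi : 'I_s -> vfield M) (eta : 'I_s -> covfield M).

Lemma vtopE X p : vtop xi eta X p = X p *m \sum_i eta i p *m xi i p.
Proof.
rewrite /vtop mulmx_sumr; apply: eq_bigr => i _.
by rewrite mulmxA [X p *m _]mx11_scalar mul_scalar_mx.
Qed.

Lemma vbotE X p : vbot xi eta X p = X p - X p *m \sum_i eta i p *m xi i p.
Proof. by rewrite /vbot vtopE. Qed.

Lemma vbot_in_D (X : vfield M) p : in_D eta p (X p) -> vbot xi eta X p = X p.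
Proof.
move=> XD; rewrite vbotE mulmx_sumr big1 ?subr0 // => i _.
by rewrite mulmxA XD mul0mx.
Qed.

End Projection.

(** * The Levi-Civita connection in charts *)

Section Connection.
Variables (R : realType) (m : nat) (M : smooth_manifold R m).
Implicit Types (c : chart_idx M) (p : M) (x y u v : 'rV[R]_m).
Variables (g : bilfield M).
Hypothesis gR : riemannian g.

Lemma derive_bilrep_sym c y u : chart_image c y ->
  ('D_u (bilrep c g) y)^T = 'D_u (bilrep c g) y.
Proof.
move=> cy; have [sg gs _] := gR; have [dg _] := sg c 1%N.
have [_ <-] := is_derive_trmx (diff_is_derive u (dg y cy)).
apply: near_eq_derive; near=> z.
by rewrite /bilrep !trmx_mul trmxK gs mulmxA.
Unshelve. all: by end_near. Qed.

Lemma christoffel_sym c y u v : chart_image c y ->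
  christoffel (bilrep c g) y u v = christoffel (bilrep c g) y v u.
Proof.
move=> cy.
have E : \row_k (u *m 'D_(delta_mx 0 k) (bilrep c g) y *m v^T) 0 0
    = \row_k (v *m 'D_(delta_mx 0 k) (bilrep c g) y *m u^T) 0 0.
  apply/rowP => k; rewrite [LHS]mxE [RHS]mxE.
  by rewrite (sym_form u v (derive_bilrep_sym (delta_mx 0 k) cy)).
exact: (f_equal2 (fun A r : 'rV[R]_m =>
  (2^-1 *: (A - r)) *m invmx (bilrep c g y)) (addrC _ _) E).
Qed.

Lemma torsion_free X Y p :
  nabla g X Y p - nabla g Y X p = lie_bracket X Y p.
Proof.
rewrite /nabla (christoffel_sym (X p) (Y p)); last first.
  by exists p => //; exact: chart_at_dom.
by rewrite opprD addrACA subrr addr0.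
Qed.

Lemma nabla0 X p : nabla g X (fun=> 0) p = 0.
Proof.
have E (G : 'rV[R]_m -> 'M[R]_m) x u : christoffel G x u 0 = 0.
  have e1 : u *m 'D_0 G x = 0 by rewrite derive0; exact: mulmx0.
  rewrite /christoffel e1 mul0mx trmx0 add0r.
  rewrite (_ : \row_k _ = 0) ?subr0 ?scaler0 ?mul0mx //.
  by apply/rowP => k; rewrite [LHS]mxE mulmx0 [LHS]mxE [RHS]mxE.
rewrite /nabla [christoffel _ _ _ _]E addr0.
have -> : vrep (chart_at p) (fun=> 0) = cst 0.
  by apply/funext => y; rewrite /vrep mul0mx.
exact: derive_cst.
Qed.

End Connection.

Section KStructure.
Variables (R : realType) (m : nat) (M : smooth_manifold R m).
Implicit Types (c : chart_idx M) (p : M) (x y u v : 'rV[R]_m).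
Variables (s : nat) (xi : 'I_s -> vfield M) (eta : 'I_s -> covfield M).
Variables (f Q : endofield M) (g : bilfield M).
Hypothesis hk : weak_f_K_contact xi eta f Q g.
Let hc : weak_f_contact xi eta f Q g := hk.1.
Let hw : weak_metric_f_structure xi eta f Q g := hc.1.
Hypothesis hs : (0 < s)%N.

Lemma eta_metric_rep j c y : chart_image c y ->
  (covrep c (eta j) y)^T = vrep c (xi j) y *m bilrep c g y.
Proof.
move=> /chart_imageP[cy _]; have H := eta_metric hc hs j (param c y).
rewrite /covrep /vrep /bilrep H; move: (coframeK cy).
have gs := g_sym hc (param c y); move: gs.
move: (coframe _ _) (frame _ _) (xi _ _) (g _) => C B X G Gs CB.
by rewrite !mulmxA -(mulmxA _ C) CB mulmx1 !trmx_mul trmxK Gs mulmxA.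
Qed.

(** D v stands for the derivative of g along v. The hypothesis on W is the derivative of eta = g(xi,
    .), the one on [D X] is the Killing equation, and the one on [F *m G] is the contact condition;
    the left side of the conclusion is nabla_u xi. *)
Lemma christoffel_algebra (u X : 'rV[R]_m) (G F J W : 'M[R]_m)
    (D : 'rV[R]_m -> 'M[R]_m) : G \in unitmx -> G^T = G ->
  (forall v, (D v)^T = D v) ->
  (forall v, v *m W = v *m J *m G + X *m D v) ->
  D X = - (J *m G + G *m J^T) ->
  F *m G = - (2^-1 *: (W - W^T)) ->
  u *m J + (2^-1 *: (X *m D u + u *m D X
    - \row_k (u *m D (delta_mx 0 k) *m X^T) 0 0)) *m invmx G
  = - (u *m F).
Proof.
move=> Gu Gs Ds H DX FG.
(* Symmetry of each D puts X next to the k-th derivative of g, which the derivative of eta then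
   trades for first derivatives of eta and xi. *)
have rowE : \row_k (u *m D (delta_mx 0 k) *m X^T) 0 0
    = u *m W^T - u *m G *m J^T.
  apply/rowP => k; rewrite mxE (sym_form u X (Ds _)).
  have -> : X *m D (delta_mx 0 k) = delta_mx 0 k *m (W - J *m G).
    by rewrite mulmxBr H mulmxA addrC addKr.
  have -> : u *m W^T - u *m G *m J^T = ((W - J *m G) *m u^T)^T.
    rewrite trmx_mul trmxK [(W - _)^T]linearB /= trmx_mul Gs.
    by rewrite mulmxBr mulmxA.
  by rewrite -rowE -row_mul mxE [RHS]mxE.
have XD : X *m D u = u *m W - u *m J *m G by rewrite H addrC addKr.
have uF : u *m F *m G = - (2^-1 *: (u *m W - u *m W^T)).
  by rewrite -mulmxA FG mulmxN -scalemxAr mulmxBr.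
apply: (can_inj (mulmxK Gu)); rewrite mulmxDl mulmxKV // mulNmx uF opprK.
rewrite rowE XD DX mulmxN mulmxDr !mulmxA.
move: (u *m W) (u *m W^T) (u *m J *m G) (u *m G *m J^T) => r1 r2 r3 r4.
by apply/matrixP => a b; rewrite !mxE; field.
Qed.

(* Since eta = g(xi, .) and xi is Killing, g(nabla_X xi, Y) = d eta(X, Y). *)
Lemma nabla_xi j X p : nabla g X (xi j) p = - (X p *m f p).
Proof.
pose c := chart_at p; pose y := coord c p.
have cp : cdom c p := chart_at_dom p.
have cy : chart_image c y by exists p.
have gR := wf_riemannian hw.
have [dg _] := metric_Ck hk 1 c.
have [_ e1] := is_derive_xi hc j (X p) cy.
have Wv v : v *m eta_jac eta j c y = v *m xi_jac xi j c y *m g p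
    + xi j p *m 'D_v (bilrep c g) y.
  have [dw _] := etaT_Ck hc 1 j c.
  have E := is_derive_mulmx (is_derive_xi hc j v cy)
    (diff_is_derive v (dg y cy)).
  rewrite -(bilrep_chart_at g p) -(vrep_chart_at (xi j) p).
  have e2 := deriveEjacobian v (dw y cy).
  have e3 : 'D_v (fun z => (covrep c (eta j) z)^T) y
      = 'D_v (fun z => vrep c (xi j) z *m bilrep c g z) y.
    apply: near_eq_derive; near=> z; apply: eta_metric_rep.
    by near: z; exact: near_chart_image.
  by have [_ e4] := E; exact: etrans (esym e2) (etrans e3 e4).
have FG : f p *m g p = - (2^-1 *: (eta_jac eta j c y - (eta_jac eta j c y)^T)).
  rewrite -(contact_rep hc j cy) (bilrep_chart_at g p) (endorep_chart_at f p).
  by rewrite (f_skew hc hs) opprK.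
have N := christoffel_algebra (X p) (posdef_unit (g_posdef hc p)) (g_sym hc p)
  (fun v => derive_bilrep_sym gR v cy) Wv (lie_metric hk j p) FG.
rewrite -N /nabla -/c -/y [X in X + _]e1; congr (_ + _).
by rewrite /christoffel (bilrep_chart_at g p).
Unshelve. all: by end_near. Qed.

(* As nabla_xi xi = 0 and nabla is torsion free,
   R_{X,xi} xi = nabla_xi (f X) + f [X, xi] = (L_xi f) X - f^2 X. *)
Lemma curvature_xi j (W : set M) X p : open W -> W p -> smooth_vfield_on W X ->
  curvature g X (xi j) (xi j) p = - (X p *m f p *m f p).
Proof.
move=> oW Wp sX; pose c := chart_at p; pose y := coord c p.
have cp : cdom c p := chart_at_dom p.
have cy : chart_image c y by exists p.
have gR := wf_riemannian hw.
have [dX _] := sX c 1%N.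
have {}dX : differentiable (vrep c X) y by apply: dX; exists p.
have [df _] := f_Ck hk 1 c.
pose Z : vfield M := fun q => - (X q *m f q).
have xixi : nabla g (xi j) (xi j) = fun=> 0.
  by apply/funext => q; rewrite nabla_xi (xi_f hc hs) oppr0.
have Xxi : nabla g X (xi j) = Z by apply/funext => q; rewrite nabla_xi.
(* As Z = - f X, this is the Leibniz rule with L_xi f = 0. *)
have bZ : lie_bracket (xi j) Z p = - (lie_bracket (xi j) X p *m f p).
  have e1 : 'D_(xi j p) (vrep c Z) y
      = - ('D_(xi j p) (vrep c X) y *m f p
           + X p *m (f p *m xi_jac xi j c y - xi_jac xi j c y *m f p)).
    have D := is_deriveN (is_derive_mulmx (diff_is_derive (xi j p) dX)
      (diff_is_derive (xi j p) (df y cy))).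
    have [_ e] := D; have lf := lie_f hk hs j p; rewrite -/c -/y in lf.
    rewrite lf (vrep_chart_at X p) (endorep_chart_at f p) in e.
    rewrite -e; apply: near_eq_derive; near=> z.
    transitivity (- (vrep c X z *m endorep c f z)); last by [].
    rewrite -vrep_endo_app; last by near: z; exact: near_chart_image.
    by rewrite /vrep /endo_app /Z mulNmx.
  have [_ e2] := is_derive_xi hc j (Z p) cy.
  have [_ e3] := is_derive_xi hc j (X p) cy.
  have b1 := f_equal2 (fun a b : 'rV[R]_m => a - b) e1 e2.
  have b2 := f_equal2 (fun a b : 'rV[R]_m => a - b)
    (erefl ('D_(xi j p) (vrep c X) y)) e3.
  transitivity (- (('D_(xi j p) (vrep c X) y - X p *m xi_jac xi j c y) *m f p)).
    rewrite [LHS]b1 /Z; move: (xi_jac _ _ _ _) (f p) (X p) => J F x.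
    move: ('D_(_) _ _) => DX; rewrite mulmxBr mulmxBl mulNmx !mulmxA.
    move: (DX *m F) (x *m F *m J) (x *m J *m F) => r1 r2 r3.
    by apply/rowP => k; rewrite !mxE; ring.
  by congr (- (_ *m _)); rewrite -b2.
have tf := torsion_free gR (xi j) Z p; rewrite nabla_xi bZ in tf.
have brC : lie_bracket X (xi j) p = - lie_bracket (xi j) X p.
  by rewrite -!(torsion_free gR) opprB.
rewrite /curvature xixi Xxi nabla0 nabla_xi brC sub0r.
have -> : nabla g (xi j) Z p
    = - (lie_bracket (xi j) X p *m f p) - Z p *m f p.
  by rewrite -tf opprK addrK.
rewrite /Z; move: (lie_bracket _ _ _) (f p) (X p) => B F x.
rewrite !mulNmx; move: (B *m F) (x *m F *m F) => r1 r2.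
by apply/rowP => k; rewrite !mxE; ring.
Unshelve. all: by end_near. Qed.

Lemma vbot_smooth (W : set M) X : open W -> smooth_vfield_on W X ->
  smooth_vfield_on W (vbot xi eta X).
Proof.
move=> oW sX c k; have oU := open_coord_image (i := c) oW.
have UU : coord c @` (cdom c `&` W) `<=` chart_image c.
  by move=> _ [p [cp _] <-]; exists p.
have C : Ck_on k (coord c @` (cdom c `&` W)) (fun z => vrep c X z
    *m (1%:M + (-1) *: \sum_i covrep c (eta i) z *m vrep c (xi i) z)).
  apply: Ck_on_mulmx => //; first exact: sX.
  apply: Ck_on_add => //; first exact: Ck_on_cst.
  apply: Ck_on_scale => //; first exact: Ck_on_cst.
  apply: Ck_on_sum => // i _; apply: Ck_on_mulmx => //.
    exact: Ck_on_sub UU (eta_Ck hc k i c).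
  exact: Ck_on_sub UU (xi_Ck hc k i c).
apply: (eq_Ck_on oU _ C) => z /UU /chart_imageP[cz _].
rewrite /vrep /covrep vbotE; move: (coframeK cz).
move: (coframe _ _) (frame _ _) (X _) => C' F x CF.
rewrite scaleN1r mulmxBr mulmx1 mulmxBl; congr (_ - _).
rewrite !mulmx_sumr mulmx_suml; apply: eq_bigr => i _.
by rewrite !mulmxA -(mulmxA x C' F) CF mulmx1.
Qed.

Lemma vbot_D X p : in_D eta p (vbot xi eta X p).
Proof.
move=> i; rewrite vbotE mulmxBl -mulmxA mulmx_suml (bigD1 i) //= -mulmxA.
rewrite (eta_xi hc) eqxx mulmx1 big1 ?addr0 ?subrr // => k ki.
by rewrite -mulmxA (eta_xi hc) eq_sym (negbTE ki) -scalemx1 scale0r mulmx0.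
Qed.

Lemma partial_ricci_weak (W : set M) X p : open W -> W p ->
  smooth_vfield_on W X ->
  partial_ricci xi eta g X p = s%:R *: (vbot xi eta X p *m Q p).
Proof.
move=> oW Wp sX; rewrite /partial_ricci.
have D := vbot_D X p.
have -> : s%:R *: (vbot xi eta X p *m Q p)
    = \sum_(i < s) (vbot xi eta X p *m Q p).
  by rewrite sumr_const card_ord scaler_nat.
apply: eq_bigr => j _.
have E : curvature g (vbot xi eta X) (xi j) (xi j) p = vbot xi eta X p *m Q p.
  rewrite (curvature_xi j oW Wp (vbot_smooth oW sX)) -mulmxA (wf_f_square hw).
  rewrite mulmxDr mulmxN mulmx_sumr big1 ?addr0 ?opprK // => i _.
  by rewrite mulmxA D mul0mx.
(* The outer projection changes nothing: Q is self-adjoint and fixes the xi_i, so it preserves D. *)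
rewrite vbot_in_D // E => i.
rewrite (eta_metric hc hs) -mulmxA.
have -> : Q p *m (g p *m (xi i p)^T) = g p *m (xi i p)^T.
  rewrite mulmxA -(Q_selfadjoint hc) trmx_mul (g_sym hc) -mulmxA -trmx_mul.
  by rewrite (xi_Q hc).
by rewrite -(eta_metric hc hs) D.
Qed.

(** On sections of D, d eta^i(X, Y) is - eta^i([X, Y]) / 2, and T(X, Y) is half the vertical part of
    [X, Y] since nabla is torsion free; skewness of f absorbs the sign. *)
Lemma f_Tsharp i : is_Tsharp xi eta g (xi i) f.
Proof.
split=> [p u uD j|W X Y oW [sX XD] [sY YD] p Wp].
  exact: wf_D_invariant hw _ _ uD j.
have H := hc.2 i W X Y oW sX sY p Wp.
(* Z is a section of D on the open set W, so eta^i(Z) vanishes near p, not only at p. *)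
have cov0 Z V : (forall p, W p -> in_D eta p (Z p)) ->
    vderive V (cov_app (eta i) Z) p = 0.
  move=> ZD; apply: (@derive_cst_near _ _ _ _ _ _ 0).
  have cp := chart_at_dom p.
  have oU := open_coord_image (i := chart_at p) oW.
  near=> z.
  have [q [cq Wq] <-] : (coord (chart_at p) @` (cdom (chart_at p) `&` W)) z.
    near: z; apply: open_nbhs_nbhs; split => //; by exists p.
  by rewrite /= (coordK cq) /cov_app ZD // mxE.
have etaT (T : vfield M) : bil_app g (vtop xi eta T) (xi i) p
    = (T p *m eta i p) 0 0.
  rewrite /bil_app vtopE -mulmxA -(eta_metric hc hs) -mulmxA mulmx_suml.
  rewrite (bigD1 i) //= -mulmxA (eta_xi hc) eqxx mulmx1 big1 ?addr0 // => k ki.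
  by rewrite -mulmxA (eta_xi hc) eq_sym (negbTE ki) -scalemx1 scale0r mulmx0.
rewrite /integrability_tensor etaT (torsion_free (wf_riemannian hw)).
move: H; rewrite /ext_deriv !cov0 // subrr sub0r mulrN => H.
have -> : bil_app g (endo_app f X) Y p = - bil_app g X (endo_app f Y) p.
  have E : X p *m g p *m (Y p *m f p)^T = - (X p *m f p *m g p *m (Y p)^T).
    rewrite trmx_mul !mulmxA -(mulmxA (X p)) (f_skew hc hs).
    by rewrite mulmxN mulNmx !mulmxA.
  rewrite /bil_app /endo_app E; move: (_ *m (Y p)^T) => A.
  by rewrite mxE opprK.
by rewrite H opprK -scalemxAl mxE.
Unshelve. all: by end_near. Qed.

End KStructure.

(** * The deformation *)

Section Congruence.
Variables (R : realType) (m : nat) (M : smooth_manifold R m).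
Implicit Types (c : chart_idx M) (p : M) (x y u v : 'rV[R]_m).

Lemma endorep1 c y : chart_image c y ->
  endorep c (fun=> 1%:M : 'M[R]_m) y = 1%:M :> 'M[R]_m.
Proof. by move=> /chart_imageP[cy _]; rewrite /endorep mulmx1 frameK. Qed.

Lemma endorep_unit c (A : endofield M) y : (forall p, A p \in unitmx) ->
  chart_image c y -> endorep c A y \in unitmx.
Proof.
move=> Au /chart_imageP[cy _].
have [B1 B2] := mulmx1_unit (frameK cy).
rewrite /endorep; move: (frame _ _) (coframe _ _) (A _) B1 B2 (Au (param c y)).
by move=> B C D Bu Cu Du; rewrite !unitmx_mul Bu Cu Du.
Qed.

Lemma endorep_invmx c (A : endofield M) y : (forall p, A p \in unitmx) ->
  chart_image c y -> endorep c (fun p => invmx (A p)) y = invmx (endorep c A y).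
Proof.
move=> Au cy; have eu := endorep_unit Au cy.
apply: (can_inj (mulmxK eu)); rewrite mulVmx // -endorepM //.
rewrite -(endorep1 cy); congr (endorep c _ y).
by apply/funext => p; rewrite mulVmx.
Qed.

Lemma bilrep_posdef c (h : bilfield M) y : (forall p, posdef (h p)) ->
  chart_image c y -> posdef (bilrep c h y).
Proof.
move=> hp /chart_imageP[cy _]; rewrite /bilrep.
have [hs h0] := hp (param c y); have := frameK cy.
move: (frame _ _) (coframe _ _) (h _) hs h0 => B C H hs h0 BC.
split=> [|u u0]; first by rewrite !trmx_mul trmxK hs mulmxA.
rewrite !mulmxA -(mulmxA _ B^T) -trmx_mul; apply: h0.
by apply: contra_neq u0 => uB; rewrite -[u]mulmx1 -BC mulmxA uB mul0mx.
Qed.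

End Congruence.

Section Deformation.
Variables (R : realType) (m : nat) (M : smooth_manifold R m).
Implicit Types (c : chart_idx M) (p : M) (x y u v : 'rV[R]_m).
Variables (s : nat) (xi : 'I_s -> vfield M) (eta : 'I_s -> covfield M).
Variables (f Q : endofield M) (g : bilfield M).
Hypothesis hk : weak_f_K_contact xi eta f Q g.
Let hc : weak_f_contact xi eta f Q g := hk.1.
Let hw : weak_metric_f_structure xi eta f Q g := hc.1.
Hypothesis hs : (0 < s)%N.

(** * Deformation by an invariant positive factor A commuting with the structure *)

Section Factor.
Variable A : endofield M.
Hypothesis sA : smooth_endofield A.
Hypothesis Ap : forall p, posdef (A p *m g p).
Hypothesis Af : forall p, A p *m f p = f p *m A p.
Hypothesis AQ : forall p, A p *m Q p = Q p *m A p.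
Hypothesis xiA : forall j p, xi j p *m A p = xi j p.
Hypothesis LA : endo_lie_invariant xi A.

Lemma factor_unit p : A p \in unitmx.
Proof. by have := posdef_unit (Ap p); rewrite unitmx_mul => /andP[]. Qed.

Lemma factor_selfadjoint p : g p *m (A p)^T = A p *m g p.
Proof. by rewrite -(Ap p).1 trmx_mul (g_sym hc). Qed.

Lemma factor_eta j p : A p *m eta j p = eta j p.
Proof.
rewrite (eta_metric hc hs) mulmxA -factor_selfadjoint -mulmxA -trmx_mul.
by rewrite xiA.
Qed.

(** A^-1 commutes with f, so squaring [f'] produces the two inverses in [Q']; the terms eta^i xi_i
    are unaffected because A fixes xi and eta. *)
Let f' : endofield M := fun p => invmx (A p) *m f p.
Let Q' : endofield M := fun p => invmx (A p) *m invmx (A p) *m Q p.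
Let g' : bilfield M := fun p => A p *m g p.

Lemma inv_comm (B : 'M[R]_m) p : A p *m B = B *m A p ->
  invmx (A p) *m B = B *m invmx (A p).
Proof.
move=> AB; have Au := factor_unit p.
apply: (can_inj (mulmxK Au)); rewrite mulmxKV // -mulmxA -AB mulmxA.
by rewrite mulVmx // mul1mx.
Qed.

Lemma factor_metric_algebra (a b F G q : 'M[R]_m) :
  b *m a = 1%:M -> b *m F = F *m b -> b *m q = q *m b ->
  G *m a^T = a *m G ->
  (b *m F *m (a *m G) *m (b *m F)^T = F *m G *m F^T *m b^T) *
  (a *m G *m (b *m b *m q)^T = G *m q^T *m b^T).
Proof.
move=> ba bF bq aG; have abT : a^T *m b^T = 1%:M by rewrite -trmx_mul ba trmx1.
split.
  by rewrite trmx_mul bF !mulmxA -(mulmxA F b a) ba mulmx1.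
by rewrite -(mulmxA b) bq -aG !trmx_mul !mulmxA -(mulmxA G) abT mulmx1.
Qed.

(** Compared with the identity for f, Q and g, the left side and the Q' term each gain one factor
    (A^-1)^T, which acts trivially on the eta terms. *)
Lemma factor_metric p :
  f' p *m g' p *m (f' p)^T = g' p *m (Q' p)^T - \sum_i eta i p *m (eta i p)^T.
Proof.
have Au := factor_unit p.
have [e1 e2] := factor_metric_algebra (mulVmx Au) (inv_comm (Af p))
  (inv_comm (AQ p)) (factor_selfadjoint p).
rewrite /f' /g' /Q' e1 e2 (f_metric hc) mulmxBl; congr (_ - _).
rewrite mulmx_suml; apply: eq_bigr => i _.
rewrite -mulmxA -trmx_mul; congr (_ *m _^T).
by rewrite -{1}(factor_eta i p) mulKmx.
Qed.

Lemma factor_f_square p :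
  f' p *m f' p = - Q' p + \sum_i eta i p *m xi i p.
Proof.
have Au := factor_unit p.
have E (b F : 'M[R]_m) : b *m F = F *m b ->
    b *m F *m (b *m F) = b *m b *m (F *m F).
  by move=> bF; rewrite -mulmxA (mulmxA F) -bF !mulmxA.
rewrite /f' /Q' (E _ _ (inv_comm (Af p))).
rewrite (wf_f_square hw) mulmxDr mulmxN; congr (_ + _).
rewrite mulmx_sumr; apply: eq_bigr => i _; rewrite !mulmxA; congr (_ *m _).
by rewrite -{1}(factor_eta i p) -mulmxA mulKmx // -{1}(factor_eta i p) mulKmx.
Qed.

Lemma factor_smooth_inv k c : Ck_on k (chart_image c)
  (endorep c (fun p => invmx (A p))).
Proof.
have oU := @open_chart_image _ _ _ c.
have C : Ck_on k (chart_image c) (fun y => invmx (endorep c A y)).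
  apply: Ck_on_invmx => // [y cy|]; last exact: sA.
  exact: endorep_unit factor_unit cy.
apply: (eq_Ck_on oU _ C) => y cy; rewrite endorep_invmx //.
exact: factor_unit.
Qed.

Lemma endorepM_Ck k c (B C : endofield M) :
  Ck_on k (chart_image c) (endorep c B) ->
  Ck_on k (chart_image c) (endorep c C) ->
  Ck_on k (chart_image c) (endorep c (fun p => B p *m C p)).
Proof.
move=> CB CC; have oU := @open_chart_image _ _ _ c.
apply: (eq_Ck_on oU _ (Ck_on_mulmx oU CB CC)) => y cy.
by rewrite endorepM.
Qed.

Lemma bilrepM_Ck k c : Ck_on k (chart_image c) (bilrep c g').
Proof.
have oU := @open_chart_image _ _ _ c.
apply: (eq_Ck_on oU _ (Ck_on_mulmx oU (sA c k) (metric_Ck hk k c))).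
by move=> y cy; rewrite bilrepM.
Qed.

Lemma factor_structure : weak_metric_f_structure xi eta f' Q' g'.
Proof.
have xiI j p : xi j p *m invmx (A p) = xi j p.
  by rewrite -{1}(xiA j p) mulmxK // factor_unit.
split.
- move=> c k; apply: endorepM_Ck; first exact: factor_smooth_inv.
  exact: f_Ck hk k c.
- move=> c k; apply: endorepM_Ck; last exact: Q_Ck hk k c.
  by apply: endorepM_Ck; exact: factor_smooth_inv.
- exact: wf_smooth_xi hw.
- exact: wf_smooth_eta hw.
- split=> [c k|p|p u u0]; [exact: bilrepM_Ck|exact: (Ap p).1|].
  exact: (Ap p).2.
- move=> p; rewrite /Q' !unitmx_mul !unitmx_inv factor_unit /=.
  exact: wf_Q_nonsingular hw p.
- exact: factor_f_square.
- exact: wf_eta_xi hw.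
- by move=> j p; rewrite /endo_app /Q' !mulmxA !xiI (xi_Q hc).
- by move=> p u uD i; rewrite /f' mulmxA -(mulmxA _ (f p)) (f_eta hc hs) mulmx0.
- move=> X Y p; rewrite /bil_app /endo_app /cov_app.
  have := congr1 (fun B => (X p *m B *m (Y p)^T) 0 0) (factor_metric p).
  rewrite !trmx_mul !mulmxA => ->.
  rewrite mulmxBr mulmxBl -covector_sum_form !mulmxA.
  move: (_ *m (Y p)^T) (_ *m (Y p)^T) => r1 r2.
  by rewrite !mxE.
Qed.

(** A is g-self-adjoint, so g(A X, A^-1 f Y) = g(X, f Y) and the condition is the original one. *)
Lemma factor_contact : weak_f_contact xi eta f' Q' g'.
Proof.
split=> [|i W X Y oW sX sY p Wp]; first exact: factor_structure.
rewrite -(hc.2 i W X Y oW sX sY p Wp) /bil_app /endo_app /g' /f'.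
have Au := factor_unit p.
have E : A p *m g p *m (f p)^T = g p *m (f p)^T *m (A p)^T.
  rewrite -[LHS]mulmxA (f_skew hc hs) mulmxN mulNmx !mulmxA Af.
  by rewrite -[in RHS](mulmxA (f p)) factor_selfadjoint mulmxA.
have -> : (Y p *m (invmx (A p) *m f p))^T
    = (f p)^T *m (invmx (A p))^T *m (Y p)^T.
  by rewrite !trmx_mul.
rewrite !mulmxA -(mulmxA (X p) (A p)) -(mulmxA (X p) _ (f p)^T) E.
by rewrite trmx_inv !mulmxA mulmxK ?unitmx_tr // trmx_mul !mulmxA.
Qed.

Lemma lie_factor_metric (a G DG J : 'M[R]_m) :
  DG = - (J *m G + G *m J^T) ->
  (a *m J - J *m a) *m G + a *m DG = - (J *m (a *m G) + a *m G *m J^T).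
Proof.
move=> ->; rewrite mulmxBl mulmxN mulmxDr !mulmxA.
move: (a *m J *m G) (J *m a *m G) (a *m G *m J^T) => r1 r2 r3.
by apply/matrixP => b d; rewrite !mxE; ring.
Qed.

Lemma killing_algebra (DY DZ Y Z x : 'rV[R]_m) (G J : 'M[R]_m) :
  ((DY *m G + Y *m (- (J *m G + G *m J^T))) *m Z^T + Y *m G *m DZ^T) 0 0
  = ((DY - Y *m J) *m G *m Z^T) 0 0 + (Y *m G *m (DZ - Z *m J)^T) 0 0.
Proof.
have -> : (DZ - Z *m J)^T = DZ^T - J^T *m Z^T by rewrite linearB /= trmx_mul.
rewrite !(mulmxBl, mulmxDl, mulmxBr, mulmxDr, mulNmx, mulmxN) !mulmxA.
move: (DY *m G *m Z^T) (Y *m J *m G *m Z^T) (Y *m G *m J^T *m Z^T)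
  (Y *m G *m DZ^T) => r1 r2 r3 r4.
by rewrite !mxE; ring.
Qed.

(** Invariance of A and g gives that of A g; the product rule turns it back into the Killing
    condition for arbitrary smooth Y and Z. *)
Lemma factor_killing j : killing g' (xi j).
Proof.
move=> W Y Z oW sY sZ p Wp; pose c := chart_at p; pose y := coord c p.
have cp : cdom c p := chart_at_dom p.
have cy : chart_image c y by exists p.
have Wy : (coord c @` (cdom c `&` W)) y by exists p.
have [dY _] := sY c 1%N; have [dZ _] := sZ c 1%N.
have [dA _] := sA c 1%N.
have dG' : is_derive y (xi j p) (bilrep c g')
    (- (xi_jac xi j c y *m g' p + g' p *m (xi_jac xi j c y)^T)).
  have D := is_derive_mulmx (diff_is_derive (xi j p) (dA y cy))
    (is_derive_metric hk j p).
  have LAp := LA j p; rewrite -/c -/y in LAp.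
  rewrite LAp (bilrep_chart_at g p) (endorep_chart_at A p) in D.
  rewrite (lie_factor_metric _ erefl) in D.
  apply: near_eq_is_derive D; near=> z; rewrite bilrepM //.
  by near: z; exact: near_chart_image.
have D := is_derive_mulmx (is_derive_mulmx (diff_is_derive (xi j p) (dY y Wy))
  dG') (is_derive_trmx (diff_is_derive (xi j p) (dZ y Wy))).
have [_ E1] := (is_derive_mx _ _ _ _).1 D 0 0.
rewrite (vrep_chart_at Y p) (vrep_chart_at Z p) (bilrep_chart_at g' p) in E1.
have [_ bY] := is_derive_xi hc j (Y p) cy.
have [_ bZ] := is_derive_xi hc j (Z p) cy.
have lY := f_equal2 (fun a b : 'rV[R]_m => a - b)
  (erefl ('D_(xi j p) (vrep c Y) y)) bY.
have lZ := f_equal2 (fun a b : 'rV[R]_m => a - b)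
  (erefl ('D_(xi j p) (vrep c Z) y)) bZ.
have vd : vderive (xi j) (bil_app g' Y Z) p = 'D_(xi j p)
    (fun z => (vrep c Y z *m bilrep c g' z *m (vrep c Z z)^T) 0 0) y.
  apply: near_eq_derive; near=> z; apply: bil_app_param.
  by near: z; exact: near_chart_image.
rewrite vd E1 killing_algebra.
apply: f_equal2.
  by rewrite /bil_app [lie_bracket _ Y _]lY.
by rewrite /bil_app [lie_bracket _ Z _]lZ.
Unshelve. all: by end_near. Qed.

Lemma factor_K_contact : weak_f_K_contact xi eta f' Q' g'.
Proof. by split; [exact: factor_contact|exact: factor_killing]. Qed.

End Factor.

Section Sqrt.
Variable S : endofield M.
Hypothesis SQ : forall p, S p *m S p = Q p.
Hypothesis Sp : forall p, posdef (S p *m g p).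

(** The commutator E = S B - B S satisfies S E + E S = Q B - B Q = 0. *)
Lemma sqrt_comm (B : 'M[R]_m) p : B *m Q p = Q p *m B -> S p *m B = B *m S p.
Proof.
move=> BQ; apply/eqP; rewrite -subr_eq0; apply/eqP.
apply: (sylvester_eq0 (g_posdef hc p) (Sp p)) => [u|].
  by rewrite -(mulmxA u); exact: (posdef_ge0 u (Sp p)).
rewrite mulmxBr mulmxBl !mulmxA SQ -[B *m _ *m _]mulmxA SQ BQ.
by rewrite addrA subrK subrr.
Qed.

(** The difference w = S xi - xi satisfies S w = Q xi - S xi = - w, which positivity of S forbids
    unless w = 0. *)
Lemma sqrt_xi j p : xi j p *m S p = xi j p.
Proof.
apply/eqP; rewrite -subr_eq0; apply/eqP; set w := _ - _.
have wS : w *m S p = - w.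
  by rewrite /w mulmxBl -mulmxA SQ (xi_Q hc) opprB.
apply: (posdef_eq0 (Sp p)); rewrite mulmxA wS !mulNmx mxE oppr_le0.
exact: posdef_ge0 (g_posdef hc p).
Qed.

(** In every chart the representative of S is a positive root for the representative of g, so the
    matrix result applies directly. *)
Lemma sqrt_smooth_endofield : smooth_endofield S.
Proof.
move=> c; have oU := @open_chart_image _ _ _ c.
have Gp y : chart_image c y -> posdef (bilrep c g y).
  by apply: bilrep_posdef => p; exact: g_posdef hc p.
apply: (sqrtmx_smooth (Q := endorep c Q) oU (metric_Ck hk 0 c) Gp) =>
  [y cy|y cy|k].
- by rewrite -bilrepM //; exact: bilrep_posdef.
- rewrite -endorepM //; congr (endorep c _ y); apply/funext => p; exact: SQ.
- exact: Q_Ck hk k c.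
Qed.

Definition interp (r : R) : endofield M :=
  fun p => r *: 1%:M + (1 - r) *: S p.

Lemma endorep_interp r c y : chart_image c y ->
  endorep c (interp r) y = r *: 1%:M + (1 - r) *: endorep c S y.
Proof.
move=> cy; rewrite -{1}(endorep1 cy) /endorep /interp.
move: (frame _ _) (coframe _ _) (S _) => B C T.
by rewrite mulmxDr mulmxDl -!scalemxAr -!scalemxAl.
Qed.

Lemma interp_metric r p :
  interp r p *m g p = r *: g p + (1 - r) *: (S p *m g p).
Proof. by rewrite /interp mulmxDl -!scalemxAl mul1mx. Qed.

Lemma interp_posdef r : 0 <= r <= 1 -> forall p, posdef (interp r p *m g p).
Proof.
move=> /andP[r0 r1] p; rewrite interp_metric; have gp := g_posdef hc p.
have [Ss S0] := Sp p; split=> [|u u0].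
  by rewrite trmxD ![(_ *: _)^T]linearZ /= Ss gp.1.
rewrite mulmxDr mulmxDl -!scalemxAr -!scalemxAl mxE.
rewrite [X in X + _]mxE [X in _ + X]mxE.
have [->|rn0] := eqVneq r 0.
  by rewrite mul0r add0r subr0 mul1r S0.
apply: ltr_wpDr; first by rewrite mulr_ge0 ?subr_ge0 // posdef_ge0.
by apply: mulr_gt0; [rewrite lt_def rn0|exact: gp.2].
Qed.

(** Applied at r = phi(t) for the family and at r = 0 for the limit metric. *)
Lemma interp_K_contact r : 0 <= r <= 1 ->
  weak_f_K_contact xi eta (fun p => invmx (interp r p) *m f p)
    (fun p => invmx (interp r p) *m invmx (interp r p) *m Q p)
    (fun p => interp r p *m g p).
Proof.
move=> r01; have sS := sqrt_smooth_endofield.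
have comm (B : 'M[R]_m) p : S p *m B = B *m S p ->
    interp r p *m B = B *m interp r p.
  move=> SB; rewrite /interp mulmxDl mulmxDr -!scalemxAl -!scalemxAr SB.
  by rewrite mul1mx mulmx1.
apply: factor_K_contact => [|||||].
- move=> c k; have oU := @open_chart_image _ _ _ c.
  have C : Ck_on k (chart_image c)
      (fun y => r *: 1%:M + (1 - r) *: endorep c S y).
    apply: Ck_on_add => //; first exact: Ck_on_cst.
    by apply: Ck_on_scale => //; [exact: Ck_on_cst|exact: sS].
  by apply: (eq_Ck_on oU _ C) => y cy; rewrite endorep_interp.
- exact: interp_posdef.
- by move=> p; apply/comm/sqrt_comm; exact: f_Q hc hs p.
- by move=> p; apply/comm/sqrt_comm.
- move=> j p; rewrite /interp mulmxDr -!scalemxAr mulmx1 sqrt_xi -scalerDl.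
  by rewrite addrC subrK scale1r.
- move=> j p c y; have cp : cdom c p := chart_at_dom p.
  have cy : chart_image c y by exists p.
  have [dS _] := sS c 1%N.
  have lS := lie_sqrt hk hs sS SQ Sp j p; rewrite -/c -/y in lS.
  have D : is_derive y (xi j p)
      (cst (r *: 1%:M) + (fun z => (1 - r) *: endorep c S z))
      (0 + (1 - r) *: 'D_(xi j p) (endorep c S) y).
    apply: is_deriveD; apply: is_deriveZ; exact/diff_is_derive/dS.
  have [_ E] := D; rewrite lS add0r in E.
  transitivity ('D_(xi j p)
    (cst (r *: 1%:M) + (fun z => (1 - r) *: endorep c S z)) y).
    apply: near_eq_derive; near=> z; rewrite endorep_interp //.
    by near: z; exact: near_chart_image.
  rewrite E /interp; move: (S p) (xi_jac _ _ _ _) => T J.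
  rewrite mulmxDl mulmxDr -!scalemxAl -!scalemxAr mul1mx mulmx1 scalerBr.
  by rewrite opprD addrACA subrr add0r.
Unshelve. all: by end_near. Qed.

End Sqrt.

End Deformation.

(** * The weight exp(-t^2) and its decay *)

Section Gaussian.
Variable R : realType.

Definition gauss (t : R) : R := expR (- t ^+ 2).

Lemma gauss0 : gauss 0 = 1.
Proof. by rewrite /gauss expr0n oppr0 expR0. Qed.

Lemma gauss_itv t : 0 <= gauss t <= 1.
Proof. by rewrite expR_ge0 -expR0 ler_expR oppr_le0 sqr_ge0. Qed.

(** Because - t^2 <= 1 + t for all t; this fixes the rate 1 and the factor e of the convergence. *)
Lemma gauss_le t : gauss t <= expR 1 * expR t.
Proof. by rewrite -expRD ler_expR; nra. Qed.

Lemma is_derive_gauss t : is_derive t (1 : R) gauss (- (2 * t) * gauss t).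
Proof.
have D : is_derive t (1 : R) (fun u : R => - u ^+ 2) (- (2 * t)).
  have -> : (fun u : R => - u ^+ 2) = - (id ^+ 2) by [].
  apply: is_derive_eq; congr (- _).
  by rewrite /GRing.scale /= expr1 mulr1 mulr_natl.
have E := @is_derive1_comp R expR _ t _ _ (is_derive_expR (- t ^+ 2)) D.
by apply: is_derive_eq E _; exact: mulrC.
Qed.

Lemma gauss_Ck k : Ck_on k setT gauss.
Proof.
have diff t : differentiable gauss t.
  by apply/derivable1_diffP; have [] := is_derive_gauss t.
elim: k => [|k IH]; first by move=> t _; exact: differentiable_continuous.
split=> [t _|v]; first exact: diff.
have C : Ck_on k setT (fun t : R => v * (- 2 * t * gauss t)).
  apply: Ck_on_mul; [exact: openT|exact: Ck_on_cst|].
  apply: Ck_on_mul; [exact: openT| |exact: IH].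
  apply: Ck_on_mul; [exact: openT|exact: Ck_on_cst|].
  have idC : Ck_on k setT (id : R -> R).
    case: (k) => [|k'] /=; first by move=> t _; exact: cvg_id.
    split=> [t _|w]; first by [].
    apply: (eq_Ck_on openT _ (Ck_on_cst k' setT w)) => t _.
    by rewrite derive_id.
  exact: idC.
apply: (eq_Ck_on openT _ C) => t _.
have [_ E] := is_derive_gauss t.
transitivity ('D_(v *: (1 : R)) gauss t); last by rewrite [v *: 1]mulr1.
by rewrite deriveZdir; [rewrite E !mulNr|exact: diff].
Qed.

End Gaussian.

Section IteratedDerivative.
Variables (R : realType) (V W : normedModType R) (U : set V).
Hypothesis oU : open U.

Lemma iter_derive_smooth (vs : seq V) (H : V -> W) : smooth_on U H ->
  smooth_on U (iter_derive vs H).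
Proof.
by move=> sH; elim: vs => [//|v vs IH] k; have [_ D] := IH k.+1; exact: D.
Qed.

Lemma iter_derive_scale (vs : seq V) (H : V -> W) (a : R) x : smooth_on U H ->
  U x -> iter_derive vs (fun y => a *: H y) x = a *: iter_derive vs H x.
Proof.
move=> sH; elim: vs x => [//|v vs IH] x Ux /=.
have [d _] := iter_derive_smooth vs sH 1.
rewrite -deriveZ; last exact/diff_derivable/d.
apply: near_eq_derive; near=> y; apply: IH.
by near: y; exact: open_nbhs_nbhs.
Unshelve. all: by end_near. Qed.

Lemma continuous_on_compact_bounded (H : V -> W) (K : set V) : Ck_on 0 U H ->
  compact K -> K `<=` U -> exists B : R, forall x, K x -> `|H x| <= B.
Proof.
move=> cH cK KU.
have cHK : compact (H @` K).
  apply: continuous_compact => //; apply: continuous_in_subspaceT => x.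
  by rewrite inE => /KU /cH.
have [N [_ HN]] := compact_bounded cHK.
(* [compact_bounded] supplies a bound only for constants strictly above N. *)
exists (N + 1) => x Kx; apply: (HN (N + 1)); first by rewrite ltrDl.
by exists x.
Qed.

End IteratedDerivative.

Section Family.
Variables (R : realType) (m : nat) (M : smooth_manifold R m).
Variables (g S : bilfield M).

Lemma bilrep_interp r c y :
  bilrep c (fun p => interp S r p *m g p) y
  = r *: bilrep c g y + (1 - r) *: bilrep c (fun p => S p *m g p) y.
Proof.
rewrite /bilrep interp_metric; move: (frame _ _) (g _) (S _) => B G T.
by rewrite mulmxDr mulmxDl -!scalemxAr -!scalemxAl.
Qed.

Hypothesis sg : smooth_bilfield g.
Hypothesis sSg : smooth_bilfield (fun p => S p *m g p).

Lemma interp_smooth_family :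
  smooth_family (fun t p => interp S (gauss t) p *m g p).
Proof.
move=> c k; have oU := @open_chart_image _ _ _ c.
have oU' : open [set z : 'rV[R]_m * R^o | chart_image c z.1].
  by apply: (@open_comp _ _ fst) => // z _; exact: cvg_fst.
have G1 : Ck_on k [set z : 'rV[R]_m * R^o | chart_image c z.1]
    (fun z => gauss z.2).
  apply: Ck_on_sub (Ck_on_snd 'rV[R]_m openT (gauss_Ck R k)).
  by [].
have C : Ck_on k [set z : 'rV[R]_m * R^o | chart_image c z.1]
    (fun z => gauss z.2 *: bilrep c g z.1
      + (1 + (-1) * gauss z.2) *: bilrep c (fun p => S p *m g p) z.1).
  apply: Ck_on_add => //; apply: Ck_on_scale => //.
  - exact: Ck_on_fst oU (sg c k).
  - apply: Ck_on_add => //; first exact: Ck_on_cst.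
    by apply: Ck_on_mul => //; exact: Ck_on_cst.
  - exact: Ck_on_fst oU (sSg c k).
by apply: (eq_Ck_on oU' _ C) => z _; rewrite bilrep_interp mulN1r.
Qed.

(** The difference g_t - ghat is exactly phi(t) (g_0 - ghat), so all spatial derivatives decay at
    one rate; K and [vs] only affect the bound B on a derivative of g_0 - ghat. *)
Lemma interp_exp_cvg :
  exp_cvg_ninfty (fun t p => interp S (gauss t) p *m g p)
    (fun p => S p *m g p).
Proof.
exists 1 => // c K vs cK KU; have oU := @open_chart_image _ _ _ c.
pose H y := bilrep c g y - bilrep c (fun p => S p *m g p) y.
have sH : smooth_on (chart_image c) H.
  move=> k.
  have C : Ck_on k (chart_image c) (fun y => bilrep c g y
      + (-1) *: bilrep c (fun p => S p *m g p) y).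
    apply: Ck_on_add => //; first exact: sg.
    by apply: Ck_on_scale => //; [exact: Ck_on_cst|exact: sSg].
  by apply: (eq_Ck_on oU _ C) => y _; rewrite scaleN1r.
have [B HB] := continuous_on_compact_bounded (iter_derive_smooth vs sH 0) cK KU.
exists (expR 1 * B) => t x _ Kx; rewrite mul1r.
have -> : (fun y => bilrep c (fun p => interp S (gauss t) p *m g p) y
    - bilrep c (fun p => S p *m g p) y) = (fun y => gauss t *: H y).
  apply/funext => y; rewrite bilrep_interp /H.
  move: (bilrep _ _ _) (bilrep _ _ _) => a b.
  by rewrite scalerBl scale1r scalerBr addrA addrAC addrK.
rewrite (iter_derive_scale oU vs _ sH (KU _ Kx)) normrZ mulrAC.
apply: ler_pM => //; last exact: HB.
have /andP[g0 _] := gauss_itv t.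
by rewrite ger0_norm // gauss_le.
Qed.

End Family.

Theorem theorem5p2 (R : realType) (n s : nat) (hn : (1 <= n)%N)
    (hs : (1 <= s)%N) (M : smooth_manifold R (2 * n + s)%N)
    (f0 Q0 : endofield M) (xi : 'I_s -> vfield M) (eta : 'I_s -> covfield M)
    (g0 : bilfield M) (h0 : weak_f_K_contact xi eta f0 Q0 g0) :
  exists (f Q : R -> endofield M) (g : R -> bilfield M),
    [/\ smooth_family g,
        [/\ g 0 = g0, f 0 = f0 & Q 0 = Q0],
        (forall t, weak_f_K_contact xi eta (f t) (Q t) (g t)),
        (forall t (W : set M) (X : vfield M), open W ->
           D_section_on eta W X -> forall p, W p ->
           endo_app (Q t) X p = s%:R^-1 *: partial_ricci xi eta (g t) X p)
      & (forall t i, is_Tsharp xi eta (g t) (xi i) (f t))] /\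
    exists (ghat : bilfield M) (fhat : endofield M),
      [/\ exp_cvg_ninfty g ghat,
          (forall (W : set M) (X : vfield M), open W ->
             smooth_vfield_on W X -> forall p, W p ->
             partial_ricci xi eta ghat X p = s%:R *: vbot xi eta X p)
        & f_K_contact xi eta fhat ghat].
Proof.
have hc := h0.1.
have HS p : exists S : 'M[R]_(2 * n + s), S *m S = Q0 p /\ posdef (S *m g0 p).
  apply: (posdef_sqrt (g_posdef hc p) (Q_selfadjoint hc p)) => u.
  exact: (Q_posdef hc).
have [S HS'] := choice HS.
have SQ p : S p *m S p = Q0 p by have [] := HS' p.
have Sp p : posdef (S p *m g0 p) by have [] := HS' p.
have K r := interp_K_contact h0 hs SQ Sp (r := r).
have I1 p : interp S 1 p = 1%:M.
  by rewrite /interp scale1r subrr scale0r addr0.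
have I0 p : interp S 0 p = S p.
  by rewrite /interp scale0r subr0 scale1r add0r.
have sg : smooth_bilfield g0 by have [] := wf_riemannian hc.1.
have r00 : 0 <= (0 : R) <= 1 by rewrite lexx ler01.
have sSg : smooth_bilfield (fun p => S p *m g0 p).
  (* At r = 0 the deformed metric is S g_0, so its smoothness is part of the structure already
     built. *)
  have := wf_riemannian (K 0 r00).1.1; case=> sG _ _.
  suff -> : (fun p => S p *m g0 p) = (fun p => interp S 0 p *m g0 p) by [].
  by apply/funext => p; rewrite I0.
exists (fun t p => invmx (interp S (gauss t) p) *m f0 p).
exists (fun t p => invmx (interp S (gauss t) p)
  *m invmx (interp S (gauss t) p) *m Q0 p).
exists (fun t p => interp S (gauss t) p *m g0 p).
have Kt t := K _ (gauss_itv t).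
split; first split.
- exact: interp_smooth_family.
- by split; apply/funext => p; rewrite gauss0 I1 ?invmx1 !mul1mx.
- exact: Kt.
- move=> t W X oW [sX XD] p Wp.
  rewrite (partial_ricci_weak (Kt t) hs oW Wp sX) vbot_in_D; last exact: XD.
  by rewrite scalerA mulVf ?scale1r // pnatr_eq0 -lt0n.
- by move=> t i; exact: f_Tsharp (Kt t) hs i.
exists (fun p => S p *m g0 p), (fun p => invmx (S p) *m f0 p).
have Khat : f_K_contact xi eta (fun p => invmx (S p) *m f0 p)
    (fun p => S p *m g0 p).
  have := K 0 r00; rewrite /f_K_contact.
  have -> : (fun p => invmx (interp S 0 p) *m f0 p)
      = (fun p => invmx (S p) *m f0 p) by apply/funext => p; rewrite I0.
  have -> : (fun p => interp S 0 p *m g0 p) = (fun p => S p *m g0 p).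
    by apply/funext => p; rewrite I0.
  have -> // : (fun p => invmx (interp S 0 p) *m invmx (interp S 0 p) *m Q0 p)
      = (fun=> 1%:M).
  apply/funext => p; rewrite I0 -SQ mulmxA.
  have : S p *m g0 p \in unitmx by exact: posdef_unit.
  rewrite unitmx_mul => /andP[Su _].
  by rewrite -(mulmxA _ (invmx _) (S p)) mulVmx // mulmx1 mulVmx.
split=> //; first exact: interp_exp_cvg.
move=> W X oW sX p Wp.
by rewrite (partial_ricci_weak Khat hs oW Wp sX) mulmx1.
Qed.
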